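(* Let $G$ be a commutative group and let $h\colon R\to S$ be a morphism of $G$-graded commutative rings. Define functors $h_+,h^+\colon\mathrm{Mod}^G(S)\to\mathrm{Mod}^G(R)$ by $$h_+(\bullet)=h_*(\bullet\otimes_S\widetilde h(R)),\qquad h^+(\bullet)=h_*(\mathrm{Hom}^G_S(\widetilde h(R),\bullet)).$$ If the $G$-graded $R$-module $h_*(S)$ is projective and of finite type, then there is an adjunction $(h_+,h^* )$, i.e. $h_+\colon\mathrm{Mod}^G(S)\to\mathrm{Mod}^G(R)$ is left adjoint to $h^*\colon\mathrm{Mod}^G(R)\to\mathrm{Mod}^G(S)$, and there is an adjunction $(\widetilde h,h^+)$, i.e. $\widetilde h\colon\mathrm{Mod}^G(R)\to\mathrm{Mod}^G(S)$ is left adjoint to $h^+\colon\mathrm{Mod}^G(S)\to\mathrm{Mod}^G(R)$.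
   Context: All groups and rings are commutative (rings unital). $\mathrm{Mod}^G(R)$ is the category of $G$-graded $R$-modules with degree-preserving $R$-linear maps; $M(g)$ is the shift, $M(g)_{g'}=M_{g+g'}$. The tensor product $M\otimes_RN$ is graded with $x\otimes y$ in degree $\deg x+\deg y$. $\mathrm{Hom}^G_R(M,N)=\bigoplus_{g\in G}\mathrm{Hom}_{\mathrm{Mod}^G(R)}(M,N(g))$, a $G$-graded $R$-module (and likewise over $S$). $h_*\colon\mathrm{Mod}^G(S)\to\mathrm{Mod}^G(R)$ is restriction of scalars along $h$. $h^*(M)=S\otimes_RM$ (the graded tensor product $h_*(S)\otimes_RM$ with $s(t\otimes x)=(st)\otimes x$). $\widetilde h(M)=\mathrm{Hom}^G_R(h_*(S),M)$ with $S$-action $(su)(t)=u(st)$. A $G$-graded $R$-module $M$ is of finite type if there is an epimorphism $L\to M$ in $\mathrm{Mod}^G(R)$ with $L\cong\bigoplus_{i\in I}R(g_i)$ for a finite family $(g_i)_{i\in I}$ in $G$; it is projective if $\mathrm{Hom}_{\mathrm{Mod}^G(R)}(M,\bullet)$ is exact. *)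

(* Defs.v *)
From HB Require Import structures.
From mathcomp Require Import all_boot all_algebra.
From mathcomp Require Import boolp classical_sets functions.
From mathcomp Require Import freeg.

Set Implicit Arguments.
Unset Strict Implicit.
Unset Printing Implicit Defensive.

Import GRing.Theory.
Local Open Scope classical_set_scope.
Local Open Scope ring_scope.
Local Open Scope quotient_scope.

Record category := Category {
  ob :> Type;
  hom : ob -> ob -> Type;
  idm : forall X, hom X X;
  mcomp : forall X Y Z, hom Y Z -> hom X Y -> hom X Z;
  comp1m : forall X Y (f : hom X Y), mcomp (idm Y) f = f;
  compm1 : forall X Y (f : hom X Y), mcomp f (idm X) = f;
  compmA : forall X Y Z T (f : hom Z T) (g : hom Y Z) (k : hom X Y),
    mcomp f (mcomp g k) = mcomp (mcomp f g) k
}.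

Arguments idm {c} X.
Arguments mcomp {c X Y Z}.

Definition epi (C : category) (X Y : C) (f : hom X Y) : Prop :=
  forall (Z : C) (u v : hom Y Z), mcomp u f = mcomp v f -> u = v.

Definition isomorphic (C : category) (X Y : C) : Prop :=
  exists (f : hom X Y) (g : hom Y X), mcomp g f = idm X /\ mcomp f g = idm Y.

Record functor (C D : category) := Functor {
  fob :> C -> D;
  fmap : forall X Y : C, hom X Y -> hom (fob X) (fob Y);
  fmap1 : forall X : C, fmap (idm X) = idm (fob X);
  fmapM : forall (X Y Z : C) (f : hom Y Z) (g : hom X Y),
    fmap (mcomp f g) = mcomp (fmap f) (fmap g)
}.

Arguments fmap {C D} f {X Y} : rename.

Section FunctorComp.
Variables (C D E : category) (F : functor D E) (K : functor C D).

Lemma fcomp_fmap1 (X : C) : fmap F (fmap K (idm X)) = idm (F (K X)).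
Proof. by rewrite !fmap1. Qed.

Lemma fcomp_fmapM (X Y Z : C) (f : hom Y Z) (g : hom X Y) :
  fmap F (fmap K (mcomp f g)) = mcomp (fmap F (fmap K f)) (fmap F (fmap K g)).
Proof. by rewrite !fmapM. Qed.

Definition fcomp : functor C E :=
  @Functor C E (fun X => F (K X)) (fun X Y f => fmap F (fmap K f))
    fcomp_fmap1 fcomp_fmapM.

End FunctorComp.

(* An adjunction (F, U) is a bijection Hom(F X, Y) ~ Hom(X, U Y) natural in X
   and Y; F is the left adjoint. *)
Definition left_adjoint (C D : category) (F : functor C D) (U : functor D C)
    : Prop :=
  exists phi : forall (X : C) (Y : D), hom (F X) Y -> hom X (U Y),
    (forall X Y, bijective (@phi X Y)) /\
    (forall (X X' : C) (Y Y' : D) (a : hom X' X) (b : hom Y Y')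
            (f : hom (F X) Y),
       phi X' Y' (mcomp b (mcomp f (fmap F a)))
       = mcomp (fmap U b) (mcomp (phi X Y f) a)).

Inductive gen_subgroup (V : zmodType) (A : set V) : set V :=
| gen_in x : A x -> gen_subgroup A x
| gen_0 : gen_subgroup A 0
| gen_B x y : gen_subgroup A x -> gen_subgroup A y -> gen_subgroup A (x - y).

Section GenSubgroup.
Variables (V : zmodType) (A : set V).

Lemma gen_N x : gen_subgroup A x -> gen_subgroup A (- x).
Proof. by move=> Ax; rewrite -sub0r; apply: gen_B => //; apply: gen_0. Qed.

Lemma gen_D x y : gen_subgroup A x -> gen_subgroup A y -> gen_subgroup A (x + y).
Proof. by move=> Ax Ay; rewrite -[y]opprK; apply: gen_B => //; apply: gen_N. Qed.

Lemma gen_sum (I : Type) (s : seq I) (P : pred I) (F : I -> V) :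
  (forall i, P i -> gen_subgroup A (F i)) -> gen_subgroup A (\sum_(i <- s | P i) F i).
Proof. by move=> AF; elim/big_ind: _ => //; [exact: gen_0|exact: gen_D]. Qed.

End GenSubgroup.

(* The family c has finite support and sum x. *)
Definition fam_sum (G V : zmodType) (c : G -> V) (x : V) : Prop :=
  exists2 s : seq G, uniq s &
    (forall g, g \notin s -> c g = 0) /\ x = \sum_(g <- s) c g.

(* The V_ g are subgroups of V, and V is their internal direct sum. *)
Record is_grading (G V : zmodType) (V_ : G -> set V) : Prop := IsGrading {
  grading0 : forall g, V_ g 0;
  gradingB : forall g x y, V_ g x -> V_ g y -> V_ g (x - y);
  grading_direct : forall x, exists! c : G -> V,
    (forall g, V_ g (c g)) /\ fam_sum c x
}.

Lemma fam_sum0 (G V : zmodType) : fam_sum (fun _ : G => 0 : V) 0.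
Proof. by exists [::] => //; split=> //; rewrite big_nil. Qed.

Lemma fam_sum_sub (G V : zmodType) (c : G -> V) x (s t : seq G) :
  uniq s -> uniq t -> {subset s <= t} ->
  (forall g, g \notin s -> c g = 0) -> \sum_(g <- s) c g = x ->
  \sum_(g <- t) c g = x.
Proof.
move=> us ut st c0 <-.
rewrite (bigID (mem s)) /= [X in _ + X]big1 ?addr0; last by move=> i /c0.
rewrite -big_filter; apply: perm_big; apply: uniq_perm => //.
  by rewrite filter_uniq.
move=> g; rewrite mem_filter; case gs: (g \in s) => //=.
by rewrite st.
Qed.

Lemma fam_sumB (G V : zmodType) (c d : G -> V) x y :
  fam_sum c x -> fam_sum d y -> fam_sum (fun g => c g - d g) (x - y).
Proof.
move=> [s us [c0 ->]] [t ut [d0 ->]].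
exists (undup (s ++ t)); first exact: undup_uniq.
split=> [g|].
  by rewrite mem_undup mem_cat negb_or => /andP[/c0 -> /d0 ->]; rewrite subr0.
rewrite sumrB; congr (_ - _); symmetry.
  by apply: (fam_sum_sub us _ _ c0) => //; [exact: undup_uniq |
    move=> g gs; rewrite mem_undup mem_cat gs].
by apply: (fam_sum_sub ut _ _ d0) => //; [exact: undup_uniq |
  move=> g gs; rewrite mem_undup mem_cat gs orbT].
Qed.

Lemma fam_sum1 (G V : zmodType) (a : G) (x : V) :
  fam_sum (fun g => if g == a then x else 0) x.
Proof.
exists [:: a] => //; split=> [g|].
  by rewrite inE => /negbTE ->.
by rewrite big_seq1 eqxx.
Qed.

Section MkGrading.
Variables (G V : zmodType) (V_ : G -> set V).
Hypothesis V0 : forall g, V_ g 0.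
Hypothesis VB : forall g x y, V_ g x -> V_ g y -> V_ g (x - y).
Hypothesis Vgen : forall x, gen_subgroup [set x | exists g, V_ g x] x.
Hypothesis Vindep : forall c : G -> V,
  (forall g, V_ g (c g)) -> fam_sum c 0 -> forall g, c g = 0.

Lemma mk_grading : is_grading V_.
Proof.
split=> // x.
have [c [Vc cx]] : exists c : G -> V, (forall g, V_ g (c g)) /\ fam_sum c x.
  elim: (Vgen x) => {x} [x [a Vx]||x y _ [c [Vc cx]] _ [d [Vd dy]]].
  - exists (fun g => if g == a then x else 0); split; last exact: fam_sum1.
    by move=> g; case: eqP => [->|_].
  - by exists (fun=> 0); split=> //; exact: fam_sum0.
  - exists (fun g => c g - d g); split; last exact: fam_sumB.
    by move=> g; apply: VB.
exists c; split=> // d [Vd dx]; apply: funext => g.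
apply/eqP; rewrite -subr_eq0; apply/eqP.
apply: (Vindep (c := fun g => c g - d g)).
  by move=> a; apply: VB.
by rewrite -(subrr x); exact: fam_sumB.
Qed.
End MkGrading.

Section GradingTheory.
Variables (G V : zmodType) (V_ : G -> set V) (gV : is_grading V_).

Lemma gradingN g x : V_ g x -> V_ g (- x).
Proof. by move=> Vx; rewrite -sub0r; apply: (gradingB gV) => //; apply: grading0. Qed.

Lemma gradingD g x y : V_ g x -> V_ g y -> V_ g (x + y).
Proof.
by move=> Vx Vy; rewrite -[y]opprK; apply: (gradingB gV) => //; apply: gradingN.
Qed.

Definition cmp (x : V) : G -> V := projT1 (cid (grading_direct gV x)).

Lemma cmp_deg x g : V_ g (cmp x g).
Proof. by rewrite /cmp; case: cid => c /= [[Vc _] _]. Qed.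

Lemma cmp_sum x : fam_sum (cmp x) x.
Proof. by rewrite /cmp; case: cid => c /= [[_ sc] _]. Qed.

Lemma cmp_uniq x c : (forall g, V_ g (c g)) -> fam_sum c x -> cmp x = c.
Proof. by rewrite /cmp; case: cid => d /= [_ ud] Vc sc; apply: ud. Qed.

Lemma cmpB x y g : cmp (x - y) g = cmp x g - cmp y g.
Proof.
rewrite (@cmp_uniq _ (fun g => cmp x g - cmp y g)) //.
  by move=> a; apply: (gradingB gV); apply: cmp_deg.
by apply: fam_sumB; apply: cmp_sum.
Qed.

Lemma cmp_hom a x g : V_ a x -> cmp x g = if g == a then x else 0.
Proof.
move=> Vx; rewrite (@cmp_uniq _ (fun g => if g == a then x else 0)) //.
  by move=> b; case: eqP => [->|_] //; apply: grading0.
exact: fam_sum1.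
Qed.

Lemma cmp0 g : cmp 0 g = 0.
Proof. by have := cmpB 0 0 g; rewrite !subrr. Qed.

Lemma grading_gen x : gen_subgroup [set x | exists g, V_ g x] x.
Proof.
have [s _ [_ xs]] := cmp_sum x; rewrite xs; apply: gen_sum => g _; apply: gen_in.
by exists g; apply: cmp_deg.
Qed.

Lemma grading_ind (P : V -> Prop) :
  (forall g x, V_ g x -> P x) -> (forall x y, P x -> P y -> P (x - y)) ->
  forall x, P x.
Proof.
move=> Ph PB x; elim: (grading_gen x) => {x} [x [g /Ph]||x y _ Px _ Py] //.
  by apply: (Ph 0); apply: grading0.
exact: PB.
Qed.

Lemma grading_indep (c : G -> V) :
  (forall g, V_ g (c g)) -> fam_sum c 0 -> forall g, c g = 0.
Proof. by move=> Vc sc g; rewrite -(cmp_uniq Vc sc) cmp0. Qed.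

Definition supp (x : V) : seq G := projT1 (cid2 (cmp_sum x)).

Lemma supp_uniq x : uniq (supp x).
Proof. by rewrite /supp; case: cid2. Qed.

Lemma supp0 x g : g \notin supp x -> cmp x g = 0.
Proof. by rewrite /supp; case: cid2 => s us [s0 _] /= /s0. Qed.

End GradingTheory.

(* The zero ring is allowed; 1 has degree 0 automatically. *)
Record grRing (G : zmodType) := GrRing {
  grRing_sort :> comPzRingType;
  rdeg : G -> set grRing_sort;
  rdeg_grading : is_grading rdeg;
  rdegM : forall a b r s, rdeg a r -> rdeg b s -> rdeg (a + b) (r * s)
}.
Arguments rdeg {G r0} g r : rename.

Record grRingMorph (G : zmodType) (R S : grRing G) := GrRingMorph {
  grRingMorph_fun :> {rmorphism R -> S};
  grRingMorph_deg : forall g r, rdeg g r -> rdeg g (grRingMorph_fun r)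
}.

Record grMod (G : zmodType) (R : grRing G) := GrMod {
  grMod_sort :> lmodType R;
  mdeg : G -> set grMod_sort;
  mdeg_grading : is_grading mdeg;
  mdegZ : forall a b r x, rdeg a r -> mdeg b x -> mdeg (a + b) (r *: x)
}.
Arguments mdeg {G R m} g x : rename.

Section Shift.
Variables (G : zmodType) (R : grRing G) (M : grMod R) (g : G).

(* M(g)_{g'} = M_{g + g'} *)
Definition shift_deg (g' : G) : set M := mdeg (g + g').

Lemma fam_sum_shift (V : zmodType) (a : G) (c : G -> V) x :
  fam_sum c x -> fam_sum (fun g' => c (a + g')) x.
Proof.
move=> [s us [c0 ->]]; exists [seq b - a | b <- s].
  by rewrite map_inj_uniq // => b b' /addIr.
split=> [b bs|].
  apply: c0; apply: contra bs => bs.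
  by apply/mapP; exists (a + b); rewrite // addrC addKr.
by rewrite big_map; apply: eq_bigr => b _; rewrite addrC subrK.
Qed.

Lemma shift_grading : is_grading shift_deg.
Proof.
have gM := mdeg_grading M; apply: mk_grading.
- by move=> g'; apply: (grading0 gM).
- by move=> g' x y; apply: (gradingB gM).
- move=> x; elim: (grading_gen gM x) => {x} [x [a Mx]||x y _ ? _ ?].
  + by apply: gen_in; exists (a - g); rewrite /shift_deg addrC subrK.
  + exact: gen_0.
  + exact: gen_B.
- move=> c Vc sc g'.
  have Vc' a : mdeg a (c (- g + a)).
    by have := Vc (- g + a); rewrite /shift_deg addrA subrr add0r.
  by have := grading_indep gM Vc' (fam_sum_shift (- g) sc) (g + g'); rewrite addKr.
Qed.

Lemma shift_degZ a b (r : R) (x : M) :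
  rdeg a r -> shift_deg b x -> shift_deg (a + b) (r *: x).
Proof. by move=> ra xb; rewrite /shift_deg addrCA; apply: mdegZ. Qed.

Definition shift : grMod R := GrMod shift_grading shift_degZ.

End Shift.

Definition is_grhom (G : zmodType) (R : grRing G) (M N : grMod R) : set (M -> N) :=
  [set f | linear f /\ forall g x, mdeg g x -> mdeg g (f x)].

Section GrHom.
Variables (G : zmodType) (R : grRing G) (M N : grMod R).

Definition grhom_pred : {pred M -> N} := fun f => `[< is_grhom f >].

Lemma grhom_pred_closed : zmod_closed grhom_pred.
Proof.
split=> [|f g /asboolP[lf df] /asboolP[lg dg]]; apply/asboolP; split.
- by move=> r x y; rewrite -[LHS]/(0 : N) -[RHS]/(r *: 0 + 0 : N) scaler0 addr0.
- by move=> g x _; apply: (grading0 (mdeg_grading N)).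
- by move=> r x y; rewrite !fctE lf lg scalerBr opprD addrACA.
- move=> a x ax; rewrite !fctE; apply: (gradingB (mdeg_grading N)).
    exact: df.
  exact: dg.
Qed.

HB.instance Definition _ :=
  GRing.isZmodClosed.Build (M -> N) grhom_pred grhom_pred_closed.

Record grHom := GrHom {
  grHom_fun :> M -> N;
  grHom_funP : grHom_fun \in grhom_pred
}.

HB.instance Definition _ := [isSub for grHom_fun].
HB.instance Definition _ := [Choice of grHom by <:].
HB.instance Definition _ := [SubChoice_isSubZmodule of grHom by <:].

Definition mk_grHom (f : M -> N) (Hf : is_grhom f) : grHom :=
  GrHom (introT (asboolP _) Hf).

Lemma grHom_linear (f : grHom) : linear f.
Proof. by have /asboolP[] := grHom_funP f. Qed.

HB.instance Definition _ (f : grHom) :=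
  GRing.isLinear.Build R M N *:%R (grHom_fun f) (@grHom_linear f).

Lemma grHom_deg (f : grHom) g x : mdeg g x -> mdeg g (f x).
Proof. by have /asboolP[_] := grHom_funP f; apply. Qed.

Lemma grHomP (f g : grHom) : (forall x, f x = g x) -> f = g.
Proof. by move=> fg; apply: val_inj; apply: funext. Qed.

End GrHom.

Section GrModCat.
Variables (G : zmodType) (R : grRing G).
Implicit Types M N P : grMod R.

Lemma is_grhom_id M : is_grhom (id : M -> M).
Proof. by split. Qed.

Lemma is_grhom_comp M N P (f : grHom N P) (g : grHom M N) :
  is_grhom (f \o g : M -> P).
Proof.
split=> [r x y|a x ax] /=; first by rewrite !linearP.
by do 2 apply: grHom_deg.
Qed.

Definition grHom_id M : grHom M M := mk_grHom (is_grhom_id M).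
Definition grHom_comp M N P (f : grHom N P) (g : grHom M N) : grHom M P :=
  mk_grHom (is_grhom_comp f g).

Lemma grHom_comp1m M N (f : grHom M N) : grHom_comp (grHom_id N) f = f.
Proof. exact: grHomP. Qed.
Lemma grHom_compm1 M N (f : grHom M N) : grHom_comp f (grHom_id M) = f.
Proof. exact: grHomP. Qed.
Lemma grHom_compA M N P Q (f : grHom P Q) (g : grHom N P) (k : grHom M N) :
  grHom_comp f (grHom_comp g k) = grHom_comp (grHom_comp f g) k.
Proof. exact: grHomP. Qed.

Definition ModG : category :=
  @Category (grMod R) (@grHom G R) grHom_id grHom_comp
    grHom_comp1m grHom_compm1 grHom_compA.

End GrModCat.

Definition short_exact (A B C : zmodType) (f : A -> B) (g : B -> C) : Prop :=
  [/\ injective f, (forall y, g y = 0 <-> exists x, f x = y)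
    & (forall z, exists y, g y = z)].

(* The functor Hom(M, -) from Mod^G(R) to abelian groups is exact. *)
Definition gr_projective (G : zmodType) (R : grRing G) (M : grMod R) : Prop :=
  forall (A B C : grMod R) (f : grHom A B) (g : grHom B C),
    short_exact f g ->
    short_exact (fun u : grHom M A => grHom_comp f u)
                (fun u : grHom M B => grHom_comp g u).

Section Regular.
Variables (G : zmodType) (R : grRing G).

Lemma reg_degZ a b (r : R) (x : R^o) :
  rdeg a r -> rdeg b x -> rdeg (a + b) (r *: x : R^o).
Proof. exact: rdegM. Qed.

Definition regular : grMod R :=
  @GrMod G R R^o (@rdeg G R) (rdeg_grading R) reg_degZ.

End Regular.

Section Free.
Variables (G : zmodType) (R : grRing G) (I : finType) (g : I -> G).

(* The direct sum of the R(g i), i in I: the elements of degree d are those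
   whose i-th component lies in R(g i)_d for all i. *)
Definition free_deg (d : G) : set {ffun I -> R^o} :=
  [set x | forall i, mdeg d (x i : shift (regular R) (g i))].

Lemma free_grading : is_grading free_deg.
Proof.
have gr i := mdeg_grading (shift (regular R) (g i)).
apply: mk_grading.
- by move=> d i; rewrite ffunE; apply: (grading0 (gr i)).
- by move=> d x y dx dy i; rewrite !ffunE; apply: (gradingB (gr i)).
- move=> x.
  have -> : x = \sum_i [ffun j => if j == i then x i else 0].
    apply/ffunP => j; rewrite sum_ffunE (bigD1 j) //= ffunE eqxx.
    by rewrite big1 ?addr0 // => i /negbTE ij; rewrite ffunE eq_sym ij.
  apply: gen_sum => i _; move: (x i : regular R) => {}x.
  elim: (grading_gen (gr i) x) => {x} [x [d dx]||x y _ Hx _ Hy].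
  + apply: gen_in; exists d => j; rewrite ffunE; case: eqP => [->|_] //.
    exact: (grading0 (gr j)).
  + set z := (X in gen_subgroup _ X); suff -> : z = 0 by exact: gen_0.
    by apply/ffunP => j; rewrite !ffunE if_same.
  + set z := (X in gen_subgroup _ X); have -> : z =
      [ffun j => if j == i then x else 0] - [ffun j => if j == i then y else 0].
      by apply/ffunP => j; rewrite !ffunE; case: eqP => _ //; rewrite subr0.
    exact: gen_B.
- move=> c cd [s us [c0 cs]] a; apply/ffunP => i; rewrite ffunE.
  apply: (@grading_indep _ _ _ (gr i) (fun a => c a i)).
    by move=> b; apply: cd.
  exists s => //; split=> [b /c0 ->|]; first by rewrite ffunE.
  by move/ffunP: cs => /(_ i); rewrite ffunE sum_ffunE.
Qed.

Lemma free_degZ a b (r : R) (x : {ffun I -> R^o}) :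
  rdeg a r -> free_deg b x -> free_deg (a + b) (r *: x).
Proof. by move=> ra xb i; rewrite ffunE; apply: (mdegZ ra (xb i)). Qed.

Definition gr_free : grMod R := GrMod free_grading free_degZ.

End Free.

Definition gr_finite_type (G : zmodType) (R : grRing G) (M : grMod R) : Prop :=
  exists (I : finType) (g : I -> G) (L : ModG R),
    isomorphic L (gr_free R g : ModG R) /\
    exists p : hom L (M : ModG R), epi p.

Section GradedHom.
Variables (G : zmodType) (R : grRing G) (M N : grMod R).

(* Hom_{Mod^G(R)}(M, N(g)), as a set of maps from M to N *)
Definition homog (g : G) : set (M -> N) := @is_grhom G R M (shift N g).

Lemma homog0 g : homog g 0.
Proof.
split=> [r x y|a x _].
  by rewrite -[LHS]/(0 : N) -[RHS]/(r *: 0 + 0 : N) scaler0 addr0.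
exact: (grading0 (mdeg_grading N)).
Qed.

Lemma homogB g u v : homog g u -> homog g v -> homog g (u - v).
Proof.
move=> [lu du] [lv dv]; split=> [r x y|a x ax].
  by rewrite !fctE lu lv scalerBr opprD addrACA.
by rewrite !fctE; apply: (gradingB (mdeg_grading (shift N g))); [exact: du|exact: dv].
Qed.

Lemma homogZ a b (r : R) u : rdeg a r -> homog b u -> homog (a + b) (r *: u).
Proof.
move=> ra [lu du]; split=> [s x y|c x cx].
  by rewrite !fctE lu scalerDr !scalerA mulrC.
rewrite fctE /= /shift_deg -addrA; apply: mdegZ => //.
exact: (du c x cx).
Qed.

(* Hom^G_R(M, N) is realized as the sum, inside the R-module of all maps from
   M to N, of the subgroups Hom_{Mod^G(R)}(M, N(g)); this sum is direct
   ([gHom_grading]), so that it is the direct sum of these groups. *)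
Definition gHom_pred : {pred M -> N} :=
  fun u => `[< gen_subgroup [set u | exists g, homog g u] u >].

Lemma gHom_pred_closed : submod_closed gHom_pred.
Proof.
split=> [|r u v /asboolP Hu /asboolP Hv]; apply/asboolP; first exact: gen_0.
apply: gen_D => //.
elim: Hu => {u v Hv} [u [g gu]||u v _ IHu _ IHv].
- elim/(grading_ind (rdeg_grading R)): r => [a r ra|r s IHr IHs].
    by apply: gen_in; exists (a + g); apply: homogZ.
  by rewrite scalerBl; apply: gen_B.
- by rewrite scaler0; apply: gen_0.
- by rewrite scalerBr; apply: gen_B.
Qed.

HB.instance Definition _ :=
  GRing.isSubmodClosed.Build R (M -> N) gHom_pred gHom_pred_closed.

Record gHom := GHom {
  gHom_fun :> M -> N;
  gHom_funP : gHom_fun \in gHom_pred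
}.

HB.instance Definition _ := [isSub for gHom_fun].
HB.instance Definition _ := [Choice of gHom by <:].
HB.instance Definition _ := [SubChoice_isSubLmodule of gHom by <:].

Definition mk_gHom (u : M -> N)
    (Hu : gen_subgroup [set u | exists g, homog g u] u) : gHom :=
  GHom (introT (asboolP _) Hu).

Lemma gHomP (u v : gHom) : (forall x, u x = v x) -> u = v.
Proof. by move=> uv; apply: val_inj; apply: funext. Qed.

Lemma gHom_gen (u : gHom) : gen_subgroup [set u | exists g, homog g u] (gHom_fun u).
Proof. by have /asboolP := gHom_funP u. Qed.

Lemma gHom_linear (u : gHom) : linear u.
Proof.
case: u => u /= /asboolP; elim=> {u} [u [g [lu _]]||u v _ lu _ lv] r x y.
- exact: lu.
- by rewrite -[LHS]/(0 : N) -[RHS]/(r *: 0 + 0 : N) scaler0 addr0.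
- by rewrite !fctE lu lv scalerBr opprD addrACA.
Qed.

HB.instance Definition _ (u : gHom) :=
  GRing.isLinear.Build R M N *:%R (gHom_fun u) (@gHom_linear u).

Definition gHom_deg (g : G) : set gHom := [set u | homog g (gHom_fun u)].

Lemma gHom_grading : is_grading gHom_deg.
Proof.
apply: mk_grading.
- by move=> g; apply: homog0.
- by move=> g u v; apply: homogB.
- move=> [u pu].
  have [v [gv /= vu]] : exists v : gHom,
      gen_subgroup [set x | exists g, gHom_deg g x] v /\ gHom_fun v = u.
    have /asboolP := pu; elim=> {u pu} [u [g gu]||u v _ [u' [gu' <-]] _ [v' [gv' <-]]].
    + have Hu : gen_subgroup [set u | exists g, homog g u] u.
        by apply: gen_in; exists g.
      by exists (mk_gHom Hu); split=> //; apply: gen_in; exists g.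
    + by exists 0; split=> //; apply: gen_0.
    + by exists (u' - v'); split=> //; apply: gen_B.
  by have <- : v = GHom pu by apply: val_inj.
- move=> c cd [s us [c0 cs]] g; apply: gHomP => x.
  elim/(grading_ind (mdeg_grading M)): x => [b x bx|x y]; last first.
    by rewrite !linearB /= => -> ->.
  have -> : (0 : gHom) x = 0 by [].
  apply: (@grading_indep _ _ _ (mdeg_grading (shift N b)) (fun a => c a x)).
    by move=> a; have [_ /(_ b x bx)] := cd a; rewrite /= /shift_deg addrC.
  exists s => //; split=> [a /c0 -> //|].
  have E (t : seq G) : (\sum_(a <- t) c a) x = \sum_(a <- t) c a x.
    by elim: t => [|a t IHt]; rewrite ?big_nil ?big_cons // -IHt.
  by rewrite -E -cs.
Qed.

Lemma gHom_degZ a b (r : R) u : rdeg a r -> gHom_deg b u -> gHom_deg (a + b) (r *: u).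
Proof. exact: homogZ. Qed.

Definition grHomMod : grMod R := GrMod gHom_grading gHom_degZ.

End GradedHom.

Section Tensor.
Variables (R : comPzRingType) (M N : lmodType R).

(* The tensor product is the free abelian group on M * N modulo the subgroup
   generated by the bilinearity and R-balancedness relations. *)
Inductive tensor_rel : set {freeg (M * N)%type / int} :=
| tensor_relDl x x' y : tensor_rel (<< (x + x', y) >> - << (x, y) >> - << (x', y) >>)
| tensor_relDr x y y' : tensor_rel (<< (x, y + y') >> - << (x, y) >> - << (x, y') >>)
| tensor_relZ r x y : tensor_rel (<< (r *: x, y) >> - << (x, r *: y) >>).

Definition tensor_null : {pred {freeg (M * N)%type / int}} :=
  fun z => `[< gen_subgroup tensor_rel z >].

Lemma tensor_null_closed : zmod_closed tensor_null.
Proof.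
split=> [|x y /asboolP Hx /asboolP Hy]; apply/asboolP.
  exact: gen_0.
exact: gen_B.
Qed.

HB.instance Definition _ :=
  GRing.isZmodClosed.Build {freeg (M * N)%type / int} tensor_null tensor_null_closed.

Local Notation Q := (Quotient.quot tensor_null).

Definition tensor : Type := Q.

HB.instance Definition _ := GRing.Zmodule.on tensor.

Definition tens (x : M) (y : N) : tensor := \pi_Q << (x, y) >>.

Lemma pi_tensor_rel z : tensor_rel z -> \pi_Q z = 0.
Proof.
move=> Hz; have <- : \pi_Q 0 = 0 by exact: raddf0.
by apply/eqP; rewrite -Quotient.idealrBE subr0; apply/asboolP/gen_in.
Qed.

Lemma tensDl x x' y : tens (x + x') y = tens x y + tens x' y.
Proof.
apply/eqP; rewrite -subr_eq0 opprD addrA /tens -!raddfB; apply/eqP/pi_tensor_rel.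
exact: tensor_relDl.
Qed.

Lemma tensDr x y y' : tens x (y + y') = tens x y + tens x y'.
Proof.
apply/eqP; rewrite -subr_eq0 opprD addrA /tens -!raddfB; apply/eqP/pi_tensor_rel.
exact: tensor_relDr.
Qed.

Lemma tensZ r x y : tens (r *: x) y = tens x (r *: y).
Proof.
apply/eqP; rewrite -subr_eq0 /tens -!raddfB; apply/eqP/pi_tensor_rel.
exact: tensor_relZ.
Qed.

Lemma tensor_gen z : gen_subgroup [set z | exists x y, z = tens x y] z.
Proof.
rewrite -[z]reprK; move: (repr z) => {}z; rewrite -(freeg_sumE z) raddf_sum.
apply: gen_sum => -[x y] _.
have -> : << coeff (x, y) z *g (x, y) >> = << (x, y) >> *~ coeff (x, y) z.
  by rewrite freegU_mulz intz.
rewrite raddfMz -/(tens x y); have Hxy : gen_subgroup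
  [set z | exists x y, z = tens x y] (tens x y) by apply: gen_in; exists x, y.
have Hn n : gen_subgroup [set z | exists x y, z = tens x y] (tens x y *+ n).
  by elim: n => [|n IHn]; rewrite ?mulr0n ?mulrS; [exact: gen_0|exact: gen_D].
by case: (coeff _ _) => n; rewrite ?NegzE ?mulrNz; [|apply: gen_N]; exact: Hn.
Qed.

Lemma tensor_ind (P : tensor -> Prop) :
  P 0 -> (forall z z', P z -> P z' -> P (z - z')) -> (forall x y, P (tens x y)) ->
  forall z, P z.
Proof.
move=> P0 PB Pt z; elim: (tensor_gen z) => {z} [z [x [y ->]]||z z' _ Pz _ Pz'] //.
exact: PB.
Qed.

Section Lift.
Variables (B : zmodType) (f : M -> N -> B).

Definition balanced : Prop :=
  [/\ forall x x' y, f (x + x') y = f x y + f x' y,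
      forall x y y', f x (y + y') = f x y + f x y'
    & forall r x y, f (r *: x) y = f x (r *: y)].

Definition tlift (z : tensor) : B :=
  fglift (fun p => f p.1 p.2 : zmodule B) (repr z).

Hypothesis bf : balanced.

Let F (z : {freeg (M * N)%type / int}) : B := fglift (fun p => f p.1 p.2 : zmodule B) z.

Let FB z z' : F (z - z') = F z - F z'.
Proof. exact: (lift_is_additive (fun p => f p.1 p.2 : zmodule B) z z'). Qed.

Let F0 : F 0 = 0.
Proof. by have := FB 0 0; rewrite !subrr. Qed.

Let FU x y : F << (x, y) >> = f x y.
Proof. by rewrite /F liftU scale1r. Qed.

Let F_null z : z \in tensor_null -> F z = 0.
Proof.
case: bf => fDl fDr fZ.
move=> /asboolP; elim=> {z} [z Hz||z z' _ IHz _ IHz'].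
- case: {z} Hz => [x x' y|x y y'|r x y].
  + by rewrite !FB !FU fDl addrAC addrK subrr.
  + by rewrite !FB !FU fDr addrAC addrK subrr.
  + by rewrite !FB !FU fZ subrr.
- exact: F0.
- by rewrite FB IHz IHz' subrr.
Qed.

Let tlift_pi z : tlift (\pi_Q z) = F z.
Proof.
apply/eqP; rewrite -subr_eq0 -/(F _) -FB; apply/eqP; apply: F_null.
by rewrite Quotient.idealrBE reprK.
Qed.

Lemma tlift_tens x y : tlift (tens x y) = f x y.
Proof. by rewrite tlift_pi FU. Qed.

Lemma tliftB z z' : tlift (z - z') = tlift z - tlift z'.
Proof. by rewrite -[z]reprK -[z']reprK -raddfB !tlift_pi FB. Qed.

Lemma tlift0 : tlift 0 = 0.
Proof. by have := tliftB 0 0; rewrite !subrr. Qed.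

Lemma tliftD z z' : tlift (z + z') = tlift z + tlift z'.
Proof.
have E : tlift (- z') = - tlift z' by rewrite -[- z']sub0r tliftB tlift0 sub0r.
by rewrite -{1}[z']opprK tliftB E opprK.
Qed.

End Lift.


Lemma tens0l y : tens 0 y = 0.
Proof. by apply: (@addrI _ (tens 0 y)); rewrite -tensDl !addr0. Qed.

Lemma tens0r x : tens x 0 = 0.
Proof. by apply: (@addrI _ (tens x 0)); rewrite -tensDr !addr0. Qed.

Lemma tensBl x x' y : tens (x - x') y = tens x y - tens x' y.
Proof. by apply: (@addIr _ (tens x' y)); rewrite -tensDl !subrK. Qed.

Lemma tensBr x y y' : tens x (y - y') = tens x y - tens x y'.
Proof. by apply: (@addIr _ (tens x y')); rewrite -tensDr !subrK. Qed.

(* The action of a ring A on M by R-linear maps induces an action of A on the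
   tensor product. *)
Section LeftAction.
Variables (A : pzRingType) (act : A -> M -> M).

Definition lact (a : A) : tensor -> tensor := tlift (fun x y => tens (act a x) y).

Hypothesis actD : forall a x x', act a (x + x') = act a x + act a x'.
Hypothesis actZ : forall a r x, act a (r *: x) = r *: act a x.

Lemma lact_balanced a : balanced (fun x y => tens (act a x) y).
Proof.
split=> [x x' y|x y y'|r x y].
- by rewrite actD tensDl.
- by rewrite tensDr.
- by rewrite actZ tensZ.
Qed.

Lemma lact_tens a x y : lact a (tens x y) = tens (act a x) y.
Proof. exact: (tlift_tens (lact_balanced a)). Qed.

Lemma lactB a z z' : lact a (z - z') = lact a z - lact a z'.
Proof. exact: (tliftB (lact_balanced a)). Qed.

Lemma lactD a z z' : lact a (z + z') = lact a z + lact a z'.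
Proof. exact: (tliftD (lact_balanced a)). Qed.

Lemma lact0 a : lact a 0 = 0.
Proof. exact: (tlift0 (lact_balanced a)). Qed.

Lemma lactA : (forall a b x, act a (act b x) = act (a * b) x) ->
  forall a b z, lact a (lact b z) = lact (a * b) z.
Proof.
move=> actA a b; elim/tensor_ind => [|z z' IH IH'|x y].
- by rewrite !lact0.
- by rewrite !lactB IH IH'.
- by rewrite !lact_tens actA.
Qed.

Lemma lact1 : (forall x, act 1 x = x) -> forall z, lact 1 z = z.
Proof.
move=> act1; elim/tensor_ind => [|z z' IH IH'|x y].
- by rewrite !lact0.
- by rewrite !lactB IH IH'.
- by rewrite !lact_tens act1.
Qed.

Lemma lactDl : (forall a b x, act (a + b) x = act a x + act b x) ->
  forall z a b, lact (a + b) z = lact a z + lact b z.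
Proof.
move=> actDl z a b; move: z; elim/tensor_ind => [|z z' IH IH'|x y].
- by rewrite !lact0 addr0.
- by rewrite !lactB IH IH' opprD addrACA.
- by rewrite !lact_tens actDl tensDl.
Qed.

End LeftAction.

Let scaleMD (a : R) (x x' : M) : a *: (x + x') = a *: x + a *: x'.
Proof. exact: scalerDr. Qed.
Let scaleMC (a r : R) (x : M) : a *: (r *: x) = r *: (a *: x).
Proof. by rewrite !scalerA mulrC. Qed.

Definition tensor_scale : R -> tensor -> tensor := lact (fun (r : R) (x : M) => r *: x).

HB.instance Definition _ := GRing.Zmodule_isLmodule.Build R tensor
  (lactA scaleMD scaleMC (@scalerA R M))
  (lact1 scaleMD scaleMC (@scale1r R M))
  (lactD scaleMD scaleMC)
  (lactDl scaleMD scaleMC (fun a b x => @scalerDl R M x a b)).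

Lemma scale_tens r x y : r *: tens x y = tens (r *: x) y.
Proof. exact: lact_tens. Qed.

End Tensor.

Section TensorMap.
Variables (R : comPzRingType) (M M' N N' : lmodType R).
Variables (f : {linear M -> M'}) (g : {linear N -> N'}).

Definition tmap : tensor M N -> tensor M' N' := tlift (fun x y => tens (f x) (g y)).

Lemma tmap_balanced : balanced (fun x y => tens (f x) (g y)).
Proof.
split=> [x x' y|x y y'|r x y].
- by rewrite linearD tensDl.
- by rewrite linearD tensDr.
- by rewrite !linearZ /= tensZ.
Qed.

Lemma tmap_tens x y : tmap (tens x y) = tens (f x) (g y).
Proof. exact: (tlift_tens tmap_balanced). Qed.

Lemma tmapB z z' : tmap (z - z') = tmap z - tmap z'.
Proof. exact: (tliftB tmap_balanced). Qed.

Lemma tmapD z z' : tmap (z + z') = tmap z + tmap z'.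
Proof. exact: (tliftD tmap_balanced). Qed.

Lemma tmap0 : tmap 0 = 0.
Proof. exact: (tlift0 tmap_balanced). Qed.

End TensorMap.

Section GrTensor.
Variables (G : zmodType) (R : grRing G) (M N : grMod R).

Definition tensor_deg (g : G) : set (tensor M N) :=
  gen_subgroup [set z | exists a b x y,
    [/\ a + b = g, mdeg a x, mdeg b y & z = tens x y]].

Let gM := mdeg_grading M.
Let gN := mdeg_grading N.

(* x (x) y |-> sum_(a + b = g) x_a (x) y_b *)
Let pj (g : G) (x : M) (y : N) : tensor M N :=
  \sum_(a <- supp gM x) tens (cmp gM x a) (cmp gN y (g - a)).

Let pjE g x y s : uniq s -> {subset supp gM x <= s} ->
  pj g x y = \sum_(a <- s) tens (cmp gM x a) (cmp gN y (g - a)).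
Proof.
move=> us xs; symmetry.
apply: (@fam_sum_sub _ _ (fun a => tens (cmp gM x a) (cmp gN y (g - a))) _ (supp gM x)) => //.
  exact: supp_uniq.
by move=> a /supp0 ->; rewrite tens0l.
Qed.

Let pjBl g x x' y : pj g (x - x') y = pj g x y - pj g x' y.
Proof.
set s := undup (supp gM x ++ supp gM x' ++ supp gM (x - x')).
have us : uniq s by apply: undup_uniq.
rewrite !(@pjE _ _ _ s) //; try by
  move=> a ax; rewrite mem_undup !mem_cat ax ?orbT.
by rewrite -sumrB; apply: eq_bigr => a _; rewrite cmpB tensBl.
Qed.

Let pjBr g x y y' : pj g x (y - y') = pj g x y - pj g x y'.
Proof.
by rewrite /pj -sumrB; apply: eq_bigr => a _; rewrite cmpB tensBr.
Qed.

Let pj_hom g b c x y : mdeg b x -> mdeg c y ->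
  pj g x y = if g == b + c then tens x y else 0.
Proof.
move=> bx cy; rewrite (@pjE _ _ _ (undup (b :: supp gM x))); last first.
- by move=> a ax; rewrite mem_undup inE ax orbT.
- exact: undup_uniq.
rewrite (bigD1_seq b) ?undup_uniq ?mem_undup ?mem_head //= big1; last first.
  by move=> a /negbTE ab; rewrite (cmp_hom gM _ bx) ab tens0l.
rewrite addr0 (cmp_hom gM _ bx) eqxx (cmp_hom gN _ cy).
by rewrite subr_eq [c + b]addrC; case: eqP => // _; rewrite tens0r.
Qed.

Let pj_balanced g : balanced (pj g).
Proof.
have D (U V : zmodType) (f : U -> V) :
    (forall x y, f (x - y) = f x - f y) -> forall x y, f (x + y) = f x + f y.
  move=> fB x y; rewrite -{1}[y]opprK -[- y]sub0r !fB -(subrr y) fB subrr sub0r.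
  by rewrite opprK.
split.
- by move=> x x' y; apply: (D _ _ (fun x => pj g x y)) => {}x {}x'; apply: pjBl.
- by move=> x; apply: D; apply: pjBr.
- move=> r x y.
  elim/(grading_ind (rdeg_grading R)): r => [a r ra|r s IHr IHs]; last first.
    by rewrite !scalerBl pjBl pjBr IHr IHs.
  elim/(grading_ind gM): x => [b x bx|x x' IHx IHx']; last first.
    by rewrite scalerBr !pjBl IHx IHx'.
  elim/(grading_ind gN): y => [c y cy|y y' IHy IHy']; last first.
    by rewrite scalerBr !pjBr IHy IHy'.
  rewrite (pj_hom _ (mdegZ ra bx) cy) (pj_hom _ bx (mdegZ ra cy)).
  by rewrite addrCA addrA tensZ.
Qed.

Let pr g := tlift (pj g).

Let pr_hom g a z : tensor_deg a z -> pr g z = if g == a then z else 0.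
Proof.
elim=> {z} [z [b [c [x [y [<- bx cy ->]]]]]||z z' _ IH _ IH'].
- by rewrite /pr (tlift_tens (pj_balanced g)) (pj_hom _ bx cy).
- by rewrite /pr (tlift0 (pj_balanced g)) if_same.
- by rewrite /pr (tliftB (pj_balanced g)) -/(pr g) IH IH'; case: ifP => _ //; rewrite subr0.
Qed.

Lemma tensor_grading : is_grading tensor_deg.
Proof.
apply: mk_grading.
- by move=> g; apply: gen_0.
- by move=> g x y; apply: gen_B.
- elim/tensor_ind => [|z z' Hz Hz'|x y]; [exact: gen_0|exact: gen_B|].
  elim/(grading_ind gM): x => [b x bx|x x' Hx Hx']; last first.
    by rewrite tensBl; apply: gen_B.
  elim/(grading_ind gN): y => [c y cy|y y' Hy Hy']; last first.
    by rewrite tensBr; apply: gen_B.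
  by apply: gen_in; exists (b + c); apply: gen_in; exists b, c, x, y.
- move=> c dc [s us [c0 cs]] g.
  have E (t : seq G) : pr g (\sum_(a <- t) c a) = \sum_(a <- t) pr g (c a).
    elim: t => [|a t IHt]; rewrite ?big_nil ?big_cons.
      exact: (tlift0 (pj_balanced g)).
    by rewrite /pr (tliftD (pj_balanced g)) -/(pr g) IHt.
  case gs: (g \in s); last by apply: c0; rewrite gs.
  have := E s; rewrite -cs /pr (tlift0 (pj_balanced g)) -/(pr g).
  rewrite (bigD1_seq g) //= big1 ?addr0 => [|a /negbTE ag].
    by rewrite (pr_hom _ (dc g)) eqxx => <-.
  by rewrite (pr_hom _ (dc a)) eq_sym ag.
Qed.

Lemma tensor_degZ a b (r : R) z :
  rdeg a r -> tensor_deg b z -> tensor_deg (a + b) (r *: z).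
Proof.
move=> ra; elim=> {z} [z [c [d [x [y [<- cx dy ->]]]]]||z z' _ IH _ IH'].
- rewrite scale_tens; apply: gen_in; exists (a + c), d, (r *: x), y.
  by split=> //; [rewrite addrA|exact: mdegZ].
- by rewrite scaler0; apply: gen_0.
- by rewrite scalerBr; apply: gen_B.
Qed.

Definition grTensor : grMod R := GrMod tensor_grading tensor_degZ.

End GrTensor.

Section TensorFunctor.
Variables (G : zmodType) (R : grRing G) (N : grMod R).

Lemma tensor_is_grhom (X Y : grMod R) (f : grHom X Y) :
  @is_grhom G R (grTensor X N) (grTensor Y N) (tmap f idfun).
Proof.
split=> [r z z'|g z].
  rewrite tmapD; congr (_ + _).
  elim/tensor_ind: z => [|z w IH IH'|x y].
  - by rewrite scaler0 tmap0 scaler0.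
  - by rewrite scalerBr !tmapB IH IH' -scalerBr.
  - by rewrite scale_tens !tmap_tens scale_tens linearZ.
elim=> {z} [z [a [b [x [y [<- ax yb ->]]]]]||z z' _ IH _ IH'].
- rewrite tmap_tens; apply: gen_in; exists a, b, (f x), y; split=> //.
  exact: grHom_deg.
- by rewrite tmap0; apply: gen_0.
- by rewrite tmapB; apply: gen_B.
Qed.

Definition tensor_map (X Y : grMod R) (f : grHom X Y) :
  grHom (grTensor X N) (grTensor Y N) := mk_grHom (tensor_is_grhom f).

Lemma tensor_map1 (X : grMod R) : tensor_map (grHom_id X) = grHom_id (grTensor X N).
Proof.
apply: grHomP; elim/tensor_ind => [|z w IH IH'|x y].
- exact: tmap0.
- by move: IH IH'; rewrite /= => IH IH'; rewrite tmapB IH IH'.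
- exact: tmap_tens.
Qed.

Lemma tensor_mapM (X Y Z : grMod R) (f : grHom Y Z) (g : grHom X Y) :
  tensor_map (grHom_comp f g) = grHom_comp (tensor_map f) (tensor_map g).
Proof.
apply: grHomP; elim/tensor_ind => [|z w IH IH'|x y].
- by rewrite /= !tmap0.
- by move: IH IH'; rewrite /= => IH IH'; rewrite !tmapB IH IH'.
- by rewrite /= !tmap_tens.
Qed.

Definition tensor_functor : functor (ModG R) (ModG R) :=
  @Functor (ModG R) (ModG R) (fun X => grTensor X N) tensor_map tensor_map1 tensor_mapM.

End TensorFunctor.

Section HomFunctor.
Variables (G : zmodType) (R : grRing G) (N : grMod R).

Lemma homog_map (X Y : grMod R) (f : grHom X Y) g (u : N -> X) :
  homog g u -> homog g (f \o u).
Proof.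
move=> [lu du]; split=> [r x y|a x ax] /=; first by rewrite lu linearP.
exact: (grHom_deg f (du a x ax)).
Qed.

Lemma gHom_map_gen (X Y : grMod R) (f : grHom X Y) (u : gHom N X) :
  gen_subgroup [set u | exists g, homog g u] (f \o gHom_fun u).
Proof.
elim: (gHom_gen u) => {u} [u [g gu]||u v _ IH _ IH'].
- by apply: gen_in; exists g; apply: homog_map.
- by rewrite (_ : _ \o _ = 0); [exact: gen_0|apply: funext => x /=; exact: linear0].
- rewrite (_ : _ \o _ = (f \o u) - (f \o v)); first exact: gen_B.
  by apply: funext => x; exact: linearB.
Qed.

Definition hom_fun (X Y : grMod R) (f : grHom X Y) (u : gHom N X) : gHom N Y :=
  mk_gHom (gHom_map_gen f u).

Lemma hom_is_grhom (X Y : grMod R) (f : grHom X Y) :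
  @is_grhom G R (grHomMod N X) (grHomMod N Y) (hom_fun f).
Proof.
split=> [r u v|g u]; last exact: homog_map.
by apply: gHomP => x; exact: linearP.
Qed.

Definition hom_map (X Y : grMod R) (f : grHom X Y) :
  grHom (grHomMod N X) (grHomMod N Y) := mk_grHom (hom_is_grhom f).

Lemma hom_map1 (X : grMod R) : hom_map (grHom_id X) = grHom_id (grHomMod N X).
Proof. by apply: grHomP => u; apply: gHomP. Qed.

Lemma hom_mapM (X Y Z : grMod R) (f : grHom Y Z) (g : grHom X Y) :
  hom_map (grHom_comp f g) = grHom_comp (hom_map f) (hom_map g).
Proof. by apply: grHomP => u; apply: gHomP. Qed.

Definition hom_functor : functor (ModG R) (ModG R) :=
  @Functor (ModG R) (ModG R) (grHomMod N) hom_map hom_map1 hom_mapM.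

End HomFunctor.

Definition restr (R S : comPzRingType) (h : {rmorphism R -> S}) (M : lmodType S) : Type := M.

Section RestrMod.
Variables (R S : comPzRingType) (h : {rmorphism R -> S}) (M : lmodType S).

HB.instance Definition _ := GRing.Zmodule.on (restr h M).

Definition restr_scale (r : R) (x : restr h M) : restr h M := h r *: (x : M).

Lemma restr_scaleA a b x : restr_scale a (restr_scale b x) = restr_scale (a * b) x.
Proof. by rewrite /restr_scale rmorphM scalerA. Qed.
Lemma restr_scale1 : left_id 1 restr_scale.
Proof. by move=> x; rewrite /restr_scale rmorph1 scale1r. Qed.
Lemma restr_scaleDr : right_distributive restr_scale +%R.
Proof. by move=> r x y; exact: scalerDr. Qed.
Lemma restr_scaleDl x : {morph restr_scale^~ x : a b / a + b}.
Proof. by move=> a b; rewrite /restr_scale rmorphD scalerDl. Qed.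

HB.instance Definition _ := GRing.Zmodule_isLmodule.Build R (restr h M)
  restr_scaleA restr_scale1 restr_scaleDr restr_scaleDl.

End RestrMod.

Section BaseChange.
Variables (G : zmodType) (R S : grRing G) (h : grRingMorph R S).

Section LowerStar.
Variable M : grMod S.

Definition restr_deg (g : G) : set (restr h M) := @mdeg G S M g.

Lemma restr_grading : is_grading restr_deg.
Proof. exact: (mdeg_grading M). Qed.

Lemma restr_degZ a b (r : R) (x : restr h M) :
  rdeg a r -> restr_deg b x -> restr_deg (a + b) (r *: x).
Proof. by move=> /(grRingMorph_deg h) ra bx; apply: mdegZ. Qed.

Definition restr_ob : grMod R := GrMod restr_grading restr_degZ.

End LowerStar.

Lemma restr_is_grhom (M N : grMod S) (f : grHom M N) :
  @is_grhom G R (restr_ob M) (restr_ob N) f.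
Proof.
split=> [r x y|g x gx]; first exact: (linearP f (h r)).
exact: (grHom_deg f gx).
Qed.

Definition restr_map (M N : grMod S) (f : grHom M N) : grHom (restr_ob M) (restr_ob N) :=
  mk_grHom (@restr_is_grhom M N f).

Lemma restr_map1 (M : grMod S) : restr_map (grHom_id M) = grHom_id (restr_ob M).
Proof. exact: grHomP. Qed.

Lemma restr_mapM (M N P : grMod S) (f : grHom N P) (g : grHom M N) :
  restr_map (grHom_comp f g) = grHom_comp (restr_map f) (restr_map g).
Proof. exact: grHomP. Qed.

(* h_* *)
Definition lower_star : functor (ModG S) (ModG R) :=
  @Functor (ModG S) (ModG R) restr_ob restr_map restr_map1 restr_mapM.

Section UpperStar.
Variable M : grMod R.

Definition extmod : Type := tensor (restr_ob (regular S)) M.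

HB.instance Definition _ := GRing.Zmodule.on extmod.

(* s (t (x) x) = (s t) (x) x *)
Definition ext_scale : S -> extmod -> extmod :=
  lact (fun (s : S) (t : restr_ob (regular S)) => (s * (t : S) : S)).

Let mulSD (s : S) (t t' : restr_ob (regular S)) :
  (s * ((t + t' : restr_ob (regular S)) : S) : S) = s * (t : S) + s * (t' : S).
Proof. exact: mulrDr. Qed.
Let mulSC (s : S) (r : R) (t : restr_ob (regular S)) :
  (s * ((r *: t : restr_ob (regular S)) : S) : S)
  = r *: ((s * (t : S) : S) : restr_ob (regular S)).
Proof. exact: mulrCA. Qed.

HB.instance Definition _ := GRing.Zmodule_isLmodule.Build S extmod
  (lactA mulSD mulSC (@mulrA S))
  (lact1 mulSD mulSC (@mul1r S))
  (lactD mulSD mulSC)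
  (lactDl mulSD mulSC (fun a b x => @mulrDl S a b x)).

Lemma ext_scale_tens (s : S) (t : restr_ob (regular S)) (x : M) :
  s *: (tens t x : extmod) = (tens (s * (t : S) : restr_ob (regular S)) x : extmod).
Proof. exact: lact_tens. Qed.

Definition ext_deg (g : G) : set extmod := @tensor_deg G R (restr_ob (regular S)) M g.

Lemma ext_grading : is_grading ext_deg.
Proof. exact: tensor_grading. Qed.

Lemma ext_degZ a b (s : S) (z : extmod) :
  rdeg a s -> ext_deg b z -> ext_deg (a + b) (s *: z).
Proof.
move=> sa; elim=> {z} [z [c [d [t [x [<- ct dx ->]]]]]||z z' _ IH _ IH'].
- rewrite ext_scale_tens; apply: gen_in; exists (a + c), d, (s * (t : S)), x.
  by split=> //; [rewrite addrA|exact: rdegM].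
- by rewrite scaler0; apply: gen_0.
- by rewrite scalerBr; apply: gen_B.
Qed.

Definition ext_ob : grMod S := GrMod ext_grading ext_degZ.

End UpperStar.

Definition ext_fun (M N : grMod R) (f : grHom M N) : extmod M -> extmod N :=
  @tmap R (restr_ob (regular S)) (restr_ob (regular S)) M N idfun f.

Lemma ext_is_grhom (M N : grMod R) (f : grHom M N) :
  @is_grhom G S (ext_ob M) (ext_ob N) (ext_fun f).
Proof.
split=> [s z z'|g z].
  rewrite /ext_fun tmapD; congr (_ + _).
  elim/tensor_ind: z => [|z w IH IH'|t x].
  - by rewrite scaler0 tmap0 scaler0.
  - by rewrite scalerBr !tmapB IH IH'; symmetry; exact: scalerBr.
  - by rewrite ext_scale_tens !tmap_tens ext_scale_tens.
elim=> {z} [z [a [b [t [x [<- ta bx ->]]]]]||z z' _ IH _ IH'].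
- rewrite /ext_fun tmap_tens; apply: gen_in; exists a, b, t, (f x); split=> //.
  exact: grHom_deg.
- by rewrite /ext_fun tmap0; apply: gen_0.
- by rewrite /ext_fun tmapB; apply: gen_B.
Qed.

Definition ext_map (M N : grMod R) (f : grHom M N) : grHom (ext_ob M) (ext_ob N) :=
  mk_grHom (ext_is_grhom f).

Lemma ext_map1 (M : grMod R) : ext_map (grHom_id M) = grHom_id (ext_ob M).
Proof.
apply: grHomP; elim/tensor_ind => [|z w IH IH'|t x].
- exact: tmap0.
- by move: IH IH'; rewrite /= /ext_fun => IH IH'; rewrite tmapB IH IH'.
- exact: tmap_tens.
Qed.

Lemma ext_mapM (M N P : grMod R) (f : grHom N P) (g : grHom M N) :
  ext_map (grHom_comp f g) = grHom_comp (ext_map f) (ext_map g).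
Proof.
apply: grHomP; elim/tensor_ind => [|z w IH IH'|t x].
- by rewrite /= /ext_fun !tmap0.
- by move: IH IH'; rewrite /= /ext_fun => IH IH'; rewrite !tmapB IH IH'.
- by rewrite /= /ext_fun !tmap_tens.
Qed.

(* h^* *)
Definition upper_star : functor (ModG R) (ModG S) :=
  @Functor (ModG R) (ModG S) ext_ob ext_map ext_map1 ext_mapM.

Section Tilde.
Variable M : grMod R.

Definition coextmod : Type := gHom (restr_ob (regular S)) M.

HB.instance Definition _ := GRing.Zmodule.on coextmod.

Let act (s : S) (u : restr_ob (regular S) -> M) : restr_ob (regular S) -> M :=
  fun t => u (s * (t : S) : S).

Lemma act_homog a b (s : S) (u : restr_ob (regular S) -> M) :
  rdeg a s -> homog b u -> homog (a + b) (act s u).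
Proof.
move=> sa [lu du]; split=> [r x y|c t tc].
  have -> : act s u (r *: x + y) = u (r *: ((s * (x : S) : S) : restr_ob (regular S))
     + (s * (y : S) : S)).
    by rewrite /act; congr (u _); rewrite [LHS]mulrDr; congr (_ + _); exact: mulrCA.
  exact: lu.
rewrite /= /shift_deg [a + b]addrC -addrA.
exact: (du _ _ (rdegM sa tc)).
Qed.

Lemma act_gen (s : S) (u : coextmod) :
  gen_subgroup [set u | exists g, homog g u] (act s (gHom_fun u)).
Proof.
have := gHom_gen u.
elim/(grading_ind (rdeg_grading S)): s => [a s sa|s s' IH IH'] Hu; last first.
  have -> : act (s - s') (gHom_fun u) = act s (gHom_fun u) - act s' (gHom_fun u).
    apply: funext => t; rewrite /act [RHS]/=.
    by rewrite mulrBl (linearB (u : {linear restr_ob (regular S) -> M})).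
  by apply: gen_B; [exact: IH|exact: IH'].
elim: Hu => {u} [u [b bu]||u v _ IH _ IH'].
- by apply: gen_in; exists (a + b); apply: act_homog.
- exact: gen_0.
- exact: (gen_B IH IH').
Qed.

(* (s u)(t) = u (s t) *)
Definition coext_scale (s : S) (u : coextmod) : coextmod := mk_gHom (act_gen s u).

Lemma coext_scaleE s u (t : S) : coext_scale s u t = u (s * t).
Proof. by []. Qed.

Lemma coext_scaleA a b u : coext_scale a (coext_scale b u) = coext_scale (a * b) u.
Proof. by apply: gHomP => t; rewrite !coext_scaleE mulrCA mulrA. Qed.
Lemma coext_scale1 : left_id 1 coext_scale.
Proof. by move=> u; apply: gHomP => t; rewrite coext_scaleE mul1r. Qed.
Lemma coext_scaleDr : right_distributive coext_scale +%R.
Proof. by move=> s u v; apply: gHomP => t. Qed.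
Lemma coext_scaleDl u : {morph coext_scale^~ u : a b / a + b}.
Proof.
move=> a b; apply: gHomP => t; rewrite coext_scaleE mulrDl.
exact: (linearD (u : {linear restr_ob (regular S) -> M})).
Qed.

HB.instance Definition _ := GRing.Zmodule_isLmodule.Build S coextmod
  coext_scaleA coext_scale1 coext_scaleDr coext_scaleDl.

Definition coext_deg (g : G) : set coextmod := @gHom_deg G R (restr_ob (regular S)) M g.

Lemma coext_grading : is_grading coext_deg.
Proof. exact: gHom_grading. Qed.

Lemma coext_degZ a b (s : S) (u : coextmod) :
  rdeg a s -> coext_deg b u -> coext_deg (a + b) (s *: u).
Proof. exact: act_homog. Qed.

Definition coext_ob : grMod S := GrMod coext_grading coext_degZ.

End Tilde.

Lemma coext_map_gen (M N : grMod R) (f : grHom M N) (u : coextmod M) :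
  gen_subgroup [set u | exists g, homog g u] (f \o gHom_fun u).
Proof. exact: gHom_map_gen. Qed.

Definition coext_fun (M N : grMod R) (f : grHom M N) (u : coextmod M) : coextmod N :=
  mk_gHom (coext_map_gen f u).

Lemma coext_is_grhom (M N : grMod R) (f : grHom M N) :
  @is_grhom G S (coext_ob M) (coext_ob N) (coext_fun f).
Proof.
split=> [s u v|g u]; last exact: homog_map.
by apply: gHomP => t; exact: linearD.
Qed.

Definition coext_map (M N : grMod R) (f : grHom M N) : grHom (coext_ob M) (coext_ob N) :=
  mk_grHom (coext_is_grhom f).

Lemma coext_map1 (M : grMod R) : coext_map (grHom_id M) = grHom_id (coext_ob M).
Proof. by apply: grHomP => u; apply: gHomP. Qed.

Lemma coext_mapM (M N P : grMod R) (f : grHom N P) (g : grHom M N) :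
  coext_map (grHom_comp f g) = grHom_comp (coext_map f) (coext_map g).
Proof. by apply: grHomP => u; apply: gHomP. Qed.

(* M |-> Hom^G_R(h_*(S), M) *)
Definition tilde : functor (ModG R) (ModG S) :=
  @Functor (ModG R) (ModG S) coext_ob coext_map coext_map1 coext_mapM.

(* h_+ = h_*(- (x)_S tilde(R)) *)
Definition lower_plus : functor (ModG S) (ModG R) :=
  fcomp lower_star (tensor_functor (tilde (regular R))).

(* h^+ = h_*(Hom^G_S(tilde(R), -)) *)
Definition upper_plus : functor (ModG S) (ModG R) :=
  fcomp lower_star (hom_functor (tilde (regular R))).

End BaseChange.

(* Main.v *)
(** For a finitely generated projective [S], a homogeneous dual basis
    [t = \sum_i phi_i t *: e_i], with [e_i] of degree [- g_i] and [phi_i] of degree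
    [g_i], is read off a section of a graded free presentation.  With [D = tilde R],
    it gives [Hom_R(D, N) = S (x)_R N] and [tilde N = D (x)_R N], so that both
    adjunctions reduce to tensor-hom adjunction: their transposes are
    [f |-> (m |-> \sum_i e_i (x) f (m (x) phi_i))], with inverse
    [k |-> (m (x) d |-> (d (x) id) (k m))], and [f |-> (n |-> (d |-> f (d n)))], with
    inverse [k |-> (u |-> \sum_i k (u e_i) phi_i)]. *)

Require Import Defs.
From HB Require Import structures.
From mathcomp Require Import all_boot all_algebra.
From mathcomp Require Import boolp classical_sets functions.

Set Implicit Arguments.
Unset Strict Implicit.
Unset Printing Implicit Defensive.

Import GRing.Theory.
Local Open Scope classical_set_scope.
Local Open Scope ring_scope.
Local Open Scope quotient_scope.

(** * Homogeneous components under additive maps; the degree of the unit *)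

Lemma fam_sum_map (G V W : zmodType) (f : {additive V -> W}) (c : G -> V) x :
  fam_sum c x -> fam_sum (fun g => f (c g)) (f x).
Proof.
move=> [s us [c0 ->]]; exists s => //; split=> [g /c0 ->|]; first exact: raddf0.
exact: raddf_sum.
Qed.

(** Uniqueness of decompositions: the images of the components of [x] are homogeneous and sum to
    [f x]. *)
Lemma cmp_map (G V W : zmodType) (V_ : G -> set V) (W_ : G -> set W)
    (gV : is_grading V_) (gW : is_grading W_) (f : {additive V -> W}) :
  (forall g x, V_ g x -> W_ g (f x)) ->
  forall x g, cmp gW (f x) g = f (cmp gV x g).
Proof.
move=> fd x g; rewrite (cmp_uniq gW (c := fun g => f (cmp gV x g))) //.
  by move=> a; apply: fd; apply: cmp_deg.
exact: fam_sum_map (cmp_sum gV x).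
Qed.

(** Multiplication by the degree 0 component of 1 fixes every homogeneous [x], by comparison of the
    components of [x * 1] and [x] in the degree of [x]. By additivity it fixes 1 too, so 1 is that
    component. *)
Lemma rdeg1 (G : zmodType) (R : grRing G) : rdeg 0 (1 : R).
Proof.
have gR := rdeg_grading R.
suff e0 : forall x : R, x * cmp gR 1 0 = x.
  by rewrite -(e0 1) mul1r; apply: cmp_deg.
apply: (grading_ind gR) => [a x xa|x y xe ye]; last by rewrite mulrBl xe ye.
rewrite -[RHS](_ : cmp gR (x * 1) a = x); last first.
  by rewrite mulr1 (cmp_hom gR a xa) eqxx.
(* The component of [x * 1] in degree [g] is [x] times that of 1 in degree [g - a]. *)
rewrite (cmp_uniq gR (x := x * 1) (c := fun g => x * cmp gR 1 (- a + g))) ?addNr //.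
  move=> g; rewrite -{1}[g](addKr (- a)) opprK.
  by apply: rdegM => //; apply: cmp_deg.
exact: (fam_sum_map ( *:%R x : {additive R^o -> R^o}) (fam_sum_shift (- a) (cmp_sum gR 1))).
Qed.

Lemma cmp_grHom (G : zmodType) (R : grRing G) (M N : grMod R) (p : grHom M N) x g :
  cmp (mdeg_grading N) (p x) g = p (cmp (mdeg_grading M) x g).
Proof. by apply: (cmp_map _ _ (f := p)) => ? ?; exact: grHom_deg. Qed.

(** * Kernels of graded morphisms *)

Section Kernel.
Variables (G : zmodType) (R : grRing G) (M N : grMod R) (p : grHom M N).

Definition ker_pred : {pred M} := fun x => p x == 0.

Lemma ker_pred_closed : submod_closed ker_pred.
Proof.
split=> [|r x y /eqP px /eqP py]; apply/eqP; first exact: linear0.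
by rewrite linearP /= px py scaler0 addr0.
Qed.

HB.instance Definition _ := GRing.isSubmodClosed.Build R M ker_pred ker_pred_closed.

Record ker := Ker { ker_val :> M; ker_valP : ker_val \in ker_pred }.

HB.instance Definition _ := [isSub for ker_val].
HB.instance Definition _ := [Choice of ker by <:].
HB.instance Definition _ := [SubChoice_isSubLmodule of ker by <:].

Definition ker_deg (g : G) : set ker := [set x | mdeg g (ker_val x)].

(** [p] commutes with taking components; this is what makes the kernel a graded submodule. *)
Lemma cmp_ker (x : ker) g : cmp (mdeg_grading M) (ker_val x) g \in ker_pred.
Proof.
by apply/eqP; rewrite -cmp_grHom (eqP (ker_valP x)) cmp0.
Qed.

Lemma ker_grading : is_grading ker_deg.
Proof.
have gM := mdeg_grading M; apply: mk_grading.
- by move=> g; apply: (grading0 gM).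
- by move=> g x y; apply: (gradingB gM).
- move=> x; have [s _ [_ xs]] := cmp_sum (mdeg_grading M) (ker_val x).
  have -> : x = \sum_(g <- s) Ker (cmp_ker x g).
    by apply: val_inj; rewrite raddf_sum.
  by apply: gen_sum => g _; apply: gen_in; exists g; apply: cmp_deg.
- move=> c cd c0 g; apply: val_inj => /=.
  by apply: (grading_indep gM cd (fam_sum_map (val : {additive ker -> M}) c0)).
Qed.

Lemma ker_degZ a b (r : R) (x : ker) :
  rdeg a r -> ker_deg b x -> ker_deg (a + b) (r *: x).
Proof. exact: mdegZ. Qed.

Definition grker : grMod R := GrMod ker_grading ker_degZ.

Lemma ker_is_grhom : @is_grhom G R grker M ker_val.
Proof. by split. Qed.

Definition ker_incl : grHom grker M := mk_grHom ker_is_grhom.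

(** Completes a surjection to a short exact sequence, the form in which exactness of [Hom(P, -)]
    applies; the identity of [P] then lifts to a section. *)
Lemma ker_short_exact : (forall y, exists x, p x = y) -> short_exact ker_incl p.
Proof.
move=> psurj; split=> //.
  by move=> x y /= /val_inj.
move=> y; split=> [/eqP py|[x <-]]; first by exists (Ker py).
by apply/eqP; exact: ker_valP.
Qed.

End Kernel.

(** * Cokernels, and surjectivity of epimorphisms *)

Section Cokernel.
Variables (G : zmodType) (R : grRing G) (M N : grMod R) (p : grHom M N).

Definition im_pred : {pred N} := fun y => `[< exists x, p x = y >].

Lemma im_pred_closed : zmod_closed im_pred.
Proof.
split=> [|_ _ /asboolP[x <-] /asboolP[y <-]]; apply/asboolP.
  by exists 0; rewrite linear0.
by exists (x - y); rewrite linearB.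
Qed.

HB.instance Definition _ := GRing.isZmodClosed.Build N im_pred im_pred_closed.

Local Notation Q := (Quotient.quot im_pred).

Definition coker : Type := Q.

HB.instance Definition _ := GRing.Zmodule.on coker.

Definition coker_pi (y : N) : coker := \pi_Q y.

Lemma coker_piB y z : coker_pi (y - z) = coker_pi y - coker_pi z.
Proof. exact: raddfB. Qed.

HB.instance Definition _ := GRing.isZmodMorphism.Build N coker coker_pi coker_piB.

Lemma coker_pi_surj z : exists y, coker_pi y = z.
Proof. by exists (repr z); exact: reprK. Qed.

Lemma coker_pi_eq0 y : coker_pi y = 0 <-> exists x, p x = y.
Proof.
have -> : (0 : coker) = coker_pi 0 by rewrite raddf0.
split=> [/eqP|yp].
  by rewrite -Quotient.idealrBE subr0 => /asboolP.
by apply/eqP; rewrite -Quotient.idealrBE subr0; apply/asboolP.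
Qed.

(** Defined on a chosen representative; [coker_scale_pi] shows that the choice does not matter. *)
Definition coker_scale (r : R) (z : coker) : coker := coker_pi (r *: repr z).

Lemma coker_scale_pi r y : coker_scale r (coker_pi y) = coker_pi (r *: y).
Proof.
apply/eqP; rewrite /coker_scale -subr_eq0 -raddfB -scalerBr; apply/eqP.
have /coker_pi_eq0[x px] : coker_pi (repr (coker_pi y) - y) = 0.
  by rewrite raddfB /= [X in X - _](_ : _ = coker_pi y) ?subrr //; exact: reprK.
by apply/coker_pi_eq0; exists (r *: x); rewrite linearZ /= px.
Qed.

Lemma coker_scaleA a b z : coker_scale a (coker_scale b z) = coker_scale (a * b) z.
Proof. by have [y <-] := coker_pi_surj z; rewrite !coker_scale_pi scalerA. Qed.
Lemma coker_scale1 : left_id 1 coker_scale.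
Proof. by move=> z; have [y <-] := coker_pi_surj z; rewrite coker_scale_pi scale1r. Qed.
Lemma coker_scaleDr : right_distributive coker_scale +%R.
Proof.
move=> r z z'; have [y <-] := coker_pi_surj z; have [y' <-] := coker_pi_surj z'.
by rewrite -raddfD !coker_scale_pi scalerDr raddfD.
Qed.
Lemma coker_scaleDl z : {morph coker_scale^~ z : a b / a + b}.
Proof.
move=> a b; have [y <-] := coker_pi_surj z.
by rewrite !coker_scale_pi scalerDl raddfD.
Qed.

HB.instance Definition _ := GRing.Zmodule_isLmodule.Build R coker
  coker_scaleA coker_scale1 coker_scaleDr coker_scaleDl.

Definition coker_deg (g : G) : set coker := coker_pi @` mdeg g.

Lemma coker_grading : is_grading coker_deg.
Proof.
pose gN := mdeg_grading N; apply: mk_grading.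
- by move=> g; exists 0; [exact: (grading0 gN)|exact: raddf0].
- move=> g _ _ [y yg <-] [z zg <-]; exists (y - z); last exact: raddfB.
  exact: (gradingB gN).
- move=> z; have [y <-] := coker_pi_surj z.
  elim: (grading_gen gN y) => {y} [y [g gy]||y y' _ IH _ IH'].
  + by apply: gen_in; exists g, y.
  + by rewrite raddf0; apply: gen_0.
  + by rewrite raddfB; apply: gen_B.
- move=> c cd [s us [c0 cs]] g.
  (* The [c g] are lifted to homogeneous [y g], whose sum over [s] lies in the image, say equal to
     [p x]. Its component of degree [g] shows that [y g] is the image of that of [x], so [c g]
     vanishes. *)
  have /choice[y yP] : forall g, exists y, mdeg g y /\ coker_pi y = c g.
    by move=> a; have [y ya <-] := cd a; exists y.
  case gs: (g \in s); last by apply: c0; rewrite gs.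
  have /coker_pi_eq0[x px] : coker_pi (\sum_(a <- s) y a) = 0.
    by rewrite cs raddf_sum; apply: eq_bigr => a _; case: (yP a).
  rewrite -(yP g).2; apply/coker_pi_eq0; exists (cmp (mdeg_grading M) x g).
  (* A lift of zero need not be zero, so the family [y] is cut off outside [s]. *)
  rewrite -cmp_grHom px (cmp_uniq gN (c := fun a => if a \in s then y a else 0)) ?gs //.
    by move=> a; case: ifP => _; [case: (yP a)|exact: (grading0 gN)].
  exists s => //; split=> [a /negbTE -> //|].
  by rewrite !big_seq; apply: eq_bigr => a ->.
Qed.

Lemma coker_degZ a b (r : R) (z : coker) :
  rdeg a r -> coker_deg b z -> coker_deg (a + b) (r *: z).
Proof.
move=> ra [y yb <-]; exists (r *: y); first exact: mdegZ.
by rewrite -coker_scale_pi.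
Qed.

Definition grcoker : grMod R := GrMod coker_grading coker_degZ.

Lemma coker_pi_is_grhom : @is_grhom G R N grcoker coker_pi.
Proof.
split=> [r y z|g y yg]; last by exists y.
by rewrite raddfD /= -coker_scale_pi.
Qed.

(** The projection to the cokernel and the zero map agree after composition with [p], so they are
    equal and the cokernel vanishes. *)
Lemma epi_surjective : @epi (ModG R) M N p -> forall y, exists x, p x = y.
Proof.
move=> pepi y; apply/coker_pi_eq0.
have E : mk_grHom coker_pi_is_grhom = 0 :> grHom N grcoker.
  apply: pepi; apply: grHomP => x /=; apply/coker_pi_eq0; by exists x.
by have := congr1 (fun u : grHom N grcoker => u y) E.
Qed.

End Cokernel.

(** * Homogeneous dual bases of projective modules of finite type *)

Lemma gr_projective_lift (G : zmodType) (R : grRing G) (P M : grMod R)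
    (p : grHom M P) :
  gr_projective P -> (forall y, exists x, p x = y) ->
  exists s : grHom P M, grHom_comp p s = grHom_id P.
Proof. by move=> Pproj /ker_short_exact /Pproj[_ _]; apply. Qed.

Lemma gr_dual_basis (G : zmodType) (R : grRing G) (M : grMod R) :
  gr_projective M -> gr_finite_type M ->
  exists (I : finType) (g : I -> G) (e : I -> M) (phi : I -> gHom M (regular R)),
    [/\ forall i, mdeg (- g i) (e i), forall i, gHom_deg (g i) (phi i)
      & forall x, \sum_i (phi i x : R) *: e i = x].
Proof.
move=> Mproj [I [g [L [[a [b [ba _]]] [p pepi]]]]].
(* [L] is only isomorphic to the free module, so the presentation is transported along [b]. *)
pose q : grHom (gr_free R g) M := grHom_comp p b.
have qsurj y : exists x, q x = y.
  have [x <-] := epi_surjective pepi y; exists ((a : grHom L (gr_free R g)) x).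
  rewrite /=; congr (p _).
  by have := congr1 (fun u : grHom L L => u x) ba.
have [s qs] := gr_projective_lift Mproj qsurj.
have phi_homog i : homog (g i) (fun x : M => (s x : gr_free R g) i : regular R).
  split=> [r x y|d x xd]; first by rewrite linearP !ffunE.
  exact: (grHom_deg s xd i).
have phi_gen i : gen_subgroup [set u | exists d, homog d u]
    (fun x : M => (s x : gr_free R g) i : regular R).
  by apply: gen_in; exists (g i).
pose E i : gr_free R g := [ffun j => if j == i then 1 else 0].
have one_deg := rdeg1 R.
exists I, g, (fun i => q (E i)), (fun i => mk_gHom (phi_gen i)); split=> //.
  (* The unit has degree [0 = g i + (- g i)], so it lies in degree [- g i] of [R(g i)]. *)
  move=> i; apply: grHom_deg => j; rewrite ffunE; case: eqP => [->|_].
    by rewrite /= /shift_deg subrr.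
  exact: (grading0 (mdeg_grading (shift (regular R) (g j)))).
move=> x; rewrite -[RHS](congr1 (fun u : grHom M M => u x) qs : q (s x) = x).
transitivity (q (\sum_i ((s x : gr_free R g) i : R) *: E i)).
  by rewrite linear_sum; apply: eq_bigr => i _; rewrite linearZ.
congr (q _); apply/ffunP => j.
rewrite sum_ffunE (bigD1 j) //= big1 ?addr0 => [|i /negbTE ij].
  by rewrite /E !ffunE eqxx; exact: mulr1.
by rewrite /E !ffunE eq_sym ij scaler0.
Qed.

Lemma gHom_sumE (G : zmodType) (R : grRing G) (M N : grMod R) (I : Type) (s : seq I)
    (P : pred I) (u : I -> gHom M N) x :
  (\sum_(i <- s | P i) u i) x = \sum_(i <- s | P i) u i x.
Proof. by elim/big_rec2: _ => // i y z _ <-. Qed.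

Lemma balanced_suml (R : comPzRingType) (M N : lmodType R) (B : zmodType)
    (f : M -> N -> B) (I : Type) (s : seq I) (F : I -> M) y :
  balanced f -> f (\sum_(i <- s) F i) y = \sum_(i <- s) f (F i) y.
Proof.
move=> [fD _ _]; elim: s => [|i s IHs]; rewrite ?big_nil ?big_cons ?fD ?IHs //.
by apply: (@addrI _ (f 0 y)); rewrite -fD !addr0.
Qed.

Lemma balanced_sumr (R : comPzRingType) (M N : lmodType R) (B : zmodType)
    (f : M -> N -> B) (I : Type) (s : seq I) x (F : I -> N) :
  balanced f -> f x (\sum_(i <- s) F i) = \sum_(i <- s) f x (F i).
Proof.
move=> [_ fD _]; elim: s => [|i s IHs]; rewrite ?big_nil ?big_cons ?fD ?IHs //.
by apply: (@addrI _ (f x 0)); rewrite -fD !addr0.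
Qed.

Lemma tens_balanced (R : comPzRingType) (M N : lmodType R) : balanced (@tens R M N).
Proof. by split; [exact: tensDl|exact: tensDr|exact: tensZ]. Qed.

(** * Evaluation and rank one maps attached to the dual [D] of [S] *)

Section Coextension.
Variables (G : zmodType) (R S : grRing G) (h : grRingMorph R S).
Local Notation Sreg := (restr_ob h (regular S)).
Local Notation D := (coext_ob h (regular R)).

(** Since [u] is R-linear, the S-action restricted along [h] is the pointwise R-action. *)
Lemma coext_scale_rmorph (N : grMod R) (r : R) (u : coext_ob h N) t :
  (h r *: u) t = r *: u t.
Proof. exact: (linearZ_LR ((u : gHom Sreg N) : {linear Sreg -> N}) r t). Qed.

Section Evaluation.
Variables (N : grMod R).

Definition coev_fun (d : D) (t : Sreg) (n : N) : N := (d t : R) *: n.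

Lemma coev_balanced d : balanced (coev_fun d).
Proof.
rewrite /coev_fun; split=> [t t' n|t n n'|r t n].
- by rewrite linearD scalerDl.
- by rewrite scalerDr.
- by rewrite linearZ /= !scalerA mulrC.
Qed.

(* d (x) id : S (x) N -> N *)
Definition coev (d : D) : ext_ob h N -> N := tlift (coev_fun d).

Lemma coev_tens d t n : coev d (tens t n) = (d t : R) *: n.
Proof. exact: tlift_tens (coev_balanced d) t n. Qed.

Lemma coev0 d : coev d 0 = 0.
Proof. exact: tlift0 (coev_balanced d). Qed.

Lemma coevB d z w : coev d (z - w) = coev d z - coev d w.
Proof. exact: tliftB (coev_balanced d) z w. Qed.

Lemma coevD d z w : coev d (z + w) = coev d z + coev d w.
Proof. exact: tliftD (coev_balanced d) z w. Qed.

Lemma coev_sum d (I : Type) (s : seq I) (F : I -> ext_ob h N) :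
  coev d (\sum_(i <- s) F i) = \sum_(i <- s) coev d (F i).
Proof. by elim/big_rec2: _ => [|i y z _ <-]; [exact: coev0|exact: coevD]. Qed.

Lemma coevDl d d' z : coev (d + d') z = coev d z + coev d' z.
Proof.
elim/tensor_ind: z => [|z w IH IH'|t n].
- by rewrite !coev0 addr0.
- by rewrite !coevB IH IH' opprD addrACA.
- by rewrite !coev_tens -scalerDl.
Qed.

(** On [t (x) n] both sides evaluate [d] at [s * t]. This lets [coev] descend to a tensor product
    over [S]. *)
Lemma coev_scale d (s : S) z : coev (s *: d) z = coev d (s *: z).
Proof.
elim/tensor_ind: z => [|z w IH IH'|t n].
- by rewrite scaler0 !coev0.
- by rewrite scalerBr !coevB IH IH'.
- by rewrite ext_scale_tens !coev_tens.
Qed.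

Lemma coev_rmorph d (r : R) z : coev (h r *: d) z = r *: coev d z.
Proof.
elim/tensor_ind: z => [|z w IH IH'|t n].
- by rewrite !coev0 scaler0.
- by rewrite !coevB IH IH' scalerBr.
- by rewrite !coev_tens coext_scale_rmorph -scalerA.
Qed.

Lemma coev_deg a b d z : mdeg a d -> mdeg b z -> mdeg (a + b) (coev d z).
Proof.
move=> [_ da]; elim=> {z} [z [c [c' [t [n [<- tc nc' ->]]]]]||z w _ IH _ IH'].
- by rewrite coev_tens addrA; apply: mdegZ => //; exact: (da c t tc).
- by rewrite coev0; exact: (grading0 (mdeg_grading N)).
- by rewrite coevB; exact: (gradingB (mdeg_grading N)).
Qed.

(** The image of [d (x) n] under the canonical map from [D (x)_R N] to [Hom_R(S, N)]. *)
Definition rank1_fun (d : D) (n : N) : Sreg -> N := fun t => (d t : R) *: n.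

Lemma rank1_homog a b d n : mdeg a d -> mdeg b n -> homog (a + b) (rank1_fun d n).
Proof.
move=> [_ da] nb; split=> [r x y|c t tc]; rewrite /rank1_fun.
  by rewrite linearP scalerDl scalerA.
rewrite /= /shift_deg addrAC; apply: mdegZ => //; exact: (da c t tc).
Qed.

(** Neither argument need be homogeneous; additivity in each reduces to the homogeneous case. *)
Lemma rank1_gen d n : gen_subgroup [set u | exists g, homog g u] (rank1_fun d n).
Proof.
elim/(grading_ind (mdeg_grading D)): d => [a d ad|d d' IH IH']; last first.
  rewrite (_ : rank1_fun _ _ = rank1_fun d n - rank1_fun d' n); first exact: gen_B.
  by apply: funext => t; exact: scalerBl.
elim/(grading_ind (mdeg_grading N)): n => [b n bn|n n' IH IH']; last first.
  rewrite (_ : rank1_fun _ _ = rank1_fun d n - rank1_fun d n'); first exact: gen_B.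
  by apply: funext => t; exact: scalerBr.
by apply: gen_in; exists (a + b); exact: rank1_homog.
Qed.

Definition rank1 (d : D) (n : N) : coext_ob h N := mk_gHom (rank1_gen d n).

Lemma rank1E d n t : rank1 d n t = (d t : R) *: n.
Proof. by []. Qed.

Lemma rank1_linearl (s : S) d d' n :
  rank1 (s *: d + d') n = s *: rank1 d n + rank1 d' n.
Proof. by apply: gHomP => t; exact: scalerDl. Qed.

Lemma rank1_linearr (r : R) d n n' :
  rank1 d (r *: n + n') = h r *: rank1 d n + rank1 d n'.
Proof.
apply: gHomP => t; transitivity ((h r *: rank1 d n) t + rank1 d n' t); last by [].
by rewrite coext_scale_rmorph !rank1E scalerDr !scalerA mulrC.
Qed.

Lemma rank1_deg a b d n : mdeg a d -> mdeg b n -> mdeg (a + b) (rank1 d n).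
Proof. exact: rank1_homog. Qed.

End Evaluation.
End Coextension.

(** * Dual basis identities and the Casimir element *)

Section DualBasis.
Variables (G : zmodType) (R S : grRing G) (h : grRingMorph R S).
Local Notation Sreg := (restr_ob h (regular S)).
Local Notation D := (coext_ob h (regular R)).
Variables (I : finType) (g : I -> G) (e : I -> Sreg) (phi : I -> D).
Hypothesis e_deg : forall i, mdeg (- g i) (e i).
Hypothesis phi_deg : forall i, mdeg (g i) (phi i).
Hypothesis dual_basis : forall t : Sreg, \sum_i (phi i t : R) *: e i = t.

(** Applying [d] to the expansion of [t] shows that the [phi i] generate [D] over [R], with
    coordinates [d (e i)]. *)
Lemma coext_dual_basis (d : D) : \sum_i h (d (e i) : R) *: phi i = d.
Proof.
apply: gHomP => t; rewrite [LHS]gHom_sumE.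
rewrite -[in RHS](dual_basis t) [RHS](linear_sum (d : gHom Sreg (regular R))).
apply: eq_bigr => i _; rewrite [RHS]linearZ_LR.
by rewrite (coext_scale_rmorph _ (phi i)); exact: mulrC.
Qed.

(** Applying [u] to the expansion of [t] shows that the rank one maps span [Hom_R(S, N)]. *)
Lemma rank1_dual_basis (N : grMod R) (u : coext_ob h N) :
  \sum_i rank1 (phi i) (u (e i)) = u.
Proof.
apply: gHomP => t; rewrite [LHS]gHom_sumE.
rewrite -[in RHS](dual_basis t) [RHS](linear_sum (u : gHom Sreg N)).
by apply: eq_bigr => i _; rewrite [RHS]linearZ_LR.
Qed.

(* The Casimir element [\sum_i e i (x) phi i] of [S (x)_R D] does not depend on
   the side on which [S] acts. *)
Lemma casimir_scale (B : zmodType) (f : Sreg -> restr_ob h D -> B) (s : S) :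
  balanced f -> \sum_i f (s * (e i : S) : S) (phi i) = \sum_i f (e i) (s *: phi i).
Proof.
move=> bf; have [_ _ fZ] := bf.
(* [s * e i] is expanded in the [e j] and its coefficients [phi j (s * e i) = (s *: phi j) (e i)]
   cross to the other side; summing over [i] first gives [s *: phi j]. *)
under eq_bigr => i _.
  rewrite -[X in f X](dual_basis (s * (e i : S) : S)) balanced_suml //.
  under eq_bigr => j _ do rewrite fZ.
  over.
rewrite exchange_big /=; apply: eq_bigr => j _.
rewrite -(balanced_sumr _ _ _ bf); congr (f _ _).
exact: (coext_dual_basis (s *: phi j)).
Qed.

(** * The adjunction between [h_+] and [h^*] *)

Section LowerPlus.
Variables (M : grMod S) (N : grMod R).

Lemma lower_plus_scale_tens (r : R) (m : M) (d : D) :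
  r *: (tens m d : lower_plus h M) = (tens (h r *: m) d : grTensor M D).
Proof. exact: scale_tens. Qed.

Lemma lower_plus_homP (f f' : grHom (lower_plus h M) N) :
  (forall m d, f (tens m d : grTensor M D) = f' (tens m d : grTensor M D)) -> f = f'.
Proof.
move=> ff'; apply: grHomP; elim/tensor_ind => [|z w IH IH'|//].
- exact: etrans (linear0 f) (esym (linear0 f')).
- apply: etrans (linearB f z w) (etrans _ (esym (linearB f' z w))).
  by congr (_ - _); [exact: IH|exact: IH'].
Qed.

(** A scalar of [R] passes through [f] onto [m], where it acts via [h], and then across the tensor
    product over [S] onto [d]. *)
Lemma casimir_balanced (f : grHom (lower_plus h M) N) (m : M) :
  balanced (fun (t : Sreg) (d : restr_ob h D) =>
    tens t (f (tens m (d : D) : grTensor M D)) : ext_ob h N).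
Proof.
split=> [t t' d|t d d'|r t d].
- exact: tensDl.
- by rewrite tensDr linearD tensDr.
- by rewrite tensZ -linearZ_LR lower_plus_scale_tens tensZ.
Qed.

Definition lower_plus_transpose_fun (f : grHom (lower_plus h M) N) (m : M)
    : ext_ob h N :=
  \sum_i (tens (e i) (f (tens m (phi i) : grTensor M D)) : ext_ob h N).

Lemma lower_plus_transpose_is_grhom f :
  @is_grhom G S M (ext_ob h N) (lower_plus_transpose_fun f).
Proof.
split=> [s m m'|a m ma].
  rewrite /lower_plus_transpose_fun scaler_sumr.
  (* The scalar [s] first crosses from [m] to [phi i]; the Casimir identity then puts it on
     [e i]. *)
  transitivity (\sum_i (tens (e i) (f (tens m (s *: phi i) : grTensor M D))
      : ext_ob h N) + lower_plus_transpose_fun f m').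
    rewrite -big_split; apply: eq_bigr => i _ /=.
    by rewrite tensDl linearD tensDr tensZ.
  rewrite -(casimir_scale _ (casimir_balanced f m)); congr (_ + _).
  by apply: eq_bigr => i _; rewrite ext_scale_tens.
(* [e i] has degree [- g i] and [m (x) phi i] has degree [a + g i], in total [a]. *)
apply: gen_sum => i _; apply: gen_in; exists (- g i), (a + g i).
exists (e i), (f (tens m (phi i) : grTensor M D)); split=> //.
  by rewrite addrC addrK.
by apply: grHom_deg; apply: gen_in; exists a, (g i), m, (phi i).
Qed.

Definition lower_plus_transpose f : grHom M (upper_star h N) :=
  mk_grHom (lower_plus_transpose_is_grhom f).

Lemma coev_map_balanced (k : grHom M (upper_star h N)) :
  balanced (fun (m : M) (d : D) => coev d (k m)).
Proof.
split=> [m m' d|m d d'|s m d].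
- by rewrite linearD coevD.
- exact: coevDl.
- by rewrite coev_scale linearZ.
Qed.

Definition lower_plus_untranspose_fun (k : grHom M (upper_star h N))
    : lower_plus h M -> N := tlift (fun (m : M) (d : D) => coev d (k m)).

Lemma lower_plus_untranspose_is_grhom k :
  @is_grhom G R (lower_plus h M) N (lower_plus_untranspose_fun k).
Proof.
have bk := coev_map_balanced k.
have kB := tliftB bk; have k0 := tlift0 bk; have kD := tliftD bk.
have kt := tlift_tens bk.
split=> [r z z'|a].
  rewrite [LHS]kD; congr (_ + _).
  elim/tensor_ind: z => [|z w IH IH'|m d].
  - by rewrite scaler0 /lower_plus_untranspose_fun k0 scaler0.
  - by rewrite scalerBr /lower_plus_untranspose_fun !kB [X in X - _]IH [X in _ - X]IH' -scalerBr.
  - rewrite lower_plus_scale_tens [LHS]kt [X in _ = _ *: X]kt.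
    by rewrite linearZ -coev_scale coev_rmorph.
move=> z; elim=> {z} [z [c [c' [m [d [<- mc dc' ->]]]]]||z w _ IH _ IH'].
- rewrite [X in mdeg _ X]kt addrC; apply: coev_deg => //; exact: grHom_deg.
- by rewrite [X in mdeg _ X]k0; exact: (grading0 (mdeg_grading N)).
- by rewrite [X in mdeg _ X]kB; exact: (gradingB (mdeg_grading N)).
Qed.

Definition lower_plus_untranspose k : grHom (lower_plus h M) N :=
  mk_grHom (lower_plus_untranspose_is_grhom k).

Lemma lower_plus_untranspose_tens k m d :
  lower_plus_untranspose k (tens m d : grTensor M D) = coev d (k m).
Proof. exact: tlift_tens (coev_map_balanced k) m d. Qed.

(** [\sum_i d (e_i) f (m (x) phi_i) = f (m (x) \sum_i d (e_i) phi_i) = f (m (x) d)]. *)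
Lemma lower_plus_transposeK : cancel lower_plus_transpose lower_plus_untranspose.
Proof.
move=> f; apply: lower_plus_homP => m d.
rewrite lower_plus_untranspose_tens coev_sum.
transitivity (f (\sum_i (tens m (h (d (e i) : R) *: phi i) : lower_plus h M))).
  rewrite linear_sum; apply: eq_bigr => i _.
  by rewrite coev_tens -linearZ_LR lower_plus_scale_tens tensZ.
rewrite -(balanced_sumr _ _ _ (@tens_balanced S M D)).
by rewrite [X in tens m X](coext_dual_basis d).
Qed.

Lemma lower_plus_untransposeK : cancel lower_plus_untranspose lower_plus_transpose.
Proof.
move=> k; apply: grHomP => m.
transitivity (\sum_i (tens (e i) (coev (phi i) (k m)) : ext_ob h N)).
  by apply: eq_bigr => i _; rewrite lower_plus_untranspose_tens.
(* [\sum_i e_i (x) coev phi_i z = z] holds for every [z] in [S (x)_R N]; on [t (x) n] it is the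
   expansion of [t]. *)
elim/tensor_ind: (k m) => [|z w IH IH'|t n].
- by rewrite big1 // => i _; rewrite coev0 tens0r.
- rewrite -[in RHS]IH -[in RHS]IH' -sumrB; apply: eq_bigr => i _.
  by rewrite coevB tensBr.
rewrite -[in RHS](dual_basis t) balanced_suml; last exact: tens_balanced.
by apply: eq_bigr => i _; rewrite coev_tens tensZ.
Qed.

End LowerPlus.

Lemma lower_plus_left_adjoint : left_adjoint (lower_plus h) (upper_star h).
Proof.
exists (fun M N => @lower_plus_transpose M N); split=> [M N|M M' N N' a b f].
  exists (@lower_plus_untranspose M N).
    exact: lower_plus_transposeK.
  exact: lower_plus_untransposeK.
apply: grHomP => m; symmetry.
(* Naturality holds term by term: [b] acts on the second factor and [a] on [m], while [e i] and
   [phi i] stay fixed. *)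
transitivity (ext_fun b (lower_plus_transpose f ((a : grHom M' M) m))); first by [].
transitivity (\sum_i ext_fun (b : grHom N N')
   (tens (e i) (f (tens ((a : grHom M' M) m) (phi i) : grTensor M D)) : ext_ob h N)).
  exact: (linear_sum (ext_map h (b : grHom N N'))).
apply: eq_bigr => i _; rewrite /ext_fun tmap_tens /=.
congr tens; congr (b _); congr (f _); symmetry; exact: tmap_tens.
Qed.

(** * The adjunction between [tilde h] and [h^+] *)

Section UpperPlus.
Variables (N : grMod R) (M : grMod S).

Definition upper_plus_transpose_fun (f : grHom (tilde h N) M) (n : N) : D -> M :=
  fun d => f (rank1 d n).

Lemma upper_plus_transpose_homog f b n :
  mdeg b n -> homog b (upper_plus_transpose_fun f n).
Proof.
move=> nb; split=> [s d d'|a d da]; rewrite /upper_plus_transpose_fun.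
  by rewrite rank1_linearl linearP.
by rewrite /= /shift_deg addrC; apply: grHom_deg; apply: rank1_deg.
Qed.

Lemma rank1Br (d : D) (n n' : N) : rank1 d (n - n') = rank1 d n - rank1 d n'.
Proof. by apply: gHomP => t; exact: scalerBr. Qed.

Lemma upper_plus_transpose_gen f n :
  gen_subgroup [set u | exists g, homog g u] (upper_plus_transpose_fun f n).
Proof.
elim/(grading_ind (mdeg_grading N)): n => [b n bn|n n' IH IH']; last first.
  rewrite (_ : upper_plus_transpose_fun _ _ =
    upper_plus_transpose_fun f n - upper_plus_transpose_fun f n'); first exact: gen_B.
  by apply: funext => d; rewrite /upper_plus_transpose_fun rank1Br linearB.
by apply: gen_in; exists b; exact: upper_plus_transpose_homog.
Qed.

Lemma upper_plus_transpose_is_grhom f :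
  @is_grhom G R N (upper_plus h M) (fun n => mk_gHom (upper_plus_transpose_gen f n)).
Proof.
split=> [r n n'|b n nb]; last exact: upper_plus_transpose_homog.
apply: gHomP => d; transitivity (f (h r *: rank1 d n + rank1 d n')).
  by rewrite -rank1_linearr.
by rewrite linearP.
Qed.

Definition upper_plus_transpose f : grHom N (upper_plus h M) :=
  mk_grHom (upper_plus_transpose_is_grhom f).

(** Makes the Casimir identity available for the S-linearity of the inverse transpose. *)
Lemma casimir_hom_balanced (k : grHom N (upper_plus h M)) (u : coext_ob h N) :
  balanced (fun (t : Sreg) (d : restr_ob h D) => (k (u t) : gHom D M) d : M).
Proof.
split=> [t t' d|t d d'|r t d].
- by rewrite !linearD.
- exact: linearD.
- rewrite [u _]linearZ_LR [k _]linearZ_LR.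
  exact: (esym (linearZ_LR (k (u t) : gHom D M) (h r) d)).
Qed.

Definition upper_plus_untranspose_fun (k : grHom N (upper_plus h M))
    (u : tilde h N) : M := \sum_i (k ((u : coext_ob h N) (e i)) : gHom D M) (phi i).

Lemma upper_plus_untranspose_is_grhom k :
  @is_grhom G S (tilde h N) M (upper_plus_untranspose_fun k).
Proof.
split=> [s u v|a u [_ ua]].
  (* By definition [(s *: u) (e i)] is [u (s * e i)]; the Casimir identity moves [s] to [phi i], and
     values of [k] are S-linear. *)
  transitivity (\sum_i ((k ((u : coext_ob h N) (s * (e i : S) : S)) : gHom D M) (phi i))
     + upper_plus_untranspose_fun k v).
    by rewrite -big_split; apply: eq_bigr => i _ /=; rewrite linearD.
  rewrite (casimir_scale s (casimir_hom_balanced k u)) scaler_sumr.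
  by congr (_ + _); apply: eq_bigr => i _; rewrite linearZ_LR.
rewrite /upper_plus_untranspose_fun.
have MB := mdeg_grading M.
elim/big_rec: _ => [|i x _ xa]; first exact: (grading0 MB).
apply: (gradingD MB) => //.
(* [u (e i)] has degree [a - g i], hence so does its image under [k], and evaluation at [phi i] adds
   [g i]. *)
have [_ /(_ _ _ (phi_deg i))] := grHom_deg k (ua _ _ (e_deg i)).
by rewrite /= /shift_deg subrK.
Qed.

Definition upper_plus_untranspose k : grHom (tilde h N) M :=
  mk_grHom (upper_plus_untranspose_is_grhom k).

(** [f] is additive and [u] is the sum of the maps [rank1 (phi i) (u (e i))]. *)
Lemma upper_plus_transposeK : cancel upper_plus_transpose upper_plus_untranspose.
Proof.
move=> f; apply: grHomP => u; rewrite -[in RHS](rank1_dual_basis u).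
by rewrite linear_sum.
Qed.

(** [k n] is evaluated at [d = \sum_i d (e_i) phi_i]; the coefficients [d (e_i)] move onto [n] by
    R-linearity of [k]. *)
Lemma upper_plus_untransposeK : cancel upper_plus_untranspose upper_plus_transpose.
Proof.
move=> k; apply: grHomP => n; apply: gHomP => d.
rewrite -[in RHS](coext_dual_basis d) [RHS](linear_sum (k n : gHom D M)).
apply: eq_bigr => i _; rewrite [RHS](linearZ_LR (k n : gHom D M)).
by rewrite rank1E linearZ_LR.
Qed.

End UpperPlus.

Lemma tilde_left_adjoint : left_adjoint (tilde h) (upper_plus h).
Proof.
exists (fun N M => @upper_plus_transpose N M); split=> [N M|N N' M M' a b f].
  exists (@upper_plus_untranspose N M).
    exact: upper_plus_transposeK.
  exact: upper_plus_untransposeK.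
apply: grHomP => n; apply: gHomP => d /=.
rewrite /upper_plus_transpose_fun; congr (b _); congr (f _).
(* [rank1 d (a n)] is the composite of [a] with [rank1 d n], since [a] is R-linear. *)
by apply: gHomP => t; rewrite /= linearZ_LR.
Qed.

End DualBasis.

Theorem mainTheorem8 (G : zmodType) (R S : grRing G) (h : grRingMorph R S)
    (hproj : gr_projective (lower_star h (regular S)))
    (hfin : gr_finite_type (lower_star h (regular S))) :
  left_adjoint (lower_plus h) (upper_star h) /\
  left_adjoint (tilde h) (upper_plus h).
Proof.
have [I [g [e [phi [e_deg phi_deg eP]]]]] := gr_dual_basis hproj hfin.
split; first exact: (@lower_plus_left_adjoint _ _ _ _ _ g e phi).
exact: (@tilde_left_adjoint _ _ _ _ _ g e phi).
Qed.
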